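(* Let $\{\mathcal{M}_1,\ldots,\mathcal{M}_M\}$ be a finite set of models, with target $\pi(m,\boldsymbol\theta_m)=L(\boldsymbol y\mid m,\boldsymbol\theta_m)\,p(\boldsymbol\theta_m\mid m)\,p(m)$ on pairs $(m,\boldsymbol\theta_m)$, let $k\ge 1$ be an integer, and let $w^*_{m,\tilde m}(\boldsymbol\theta_m,\tilde{\boldsymbol\theta}_{\tilde m})$ be an arbitrary weighting function that is strictly positive for all $m,\tilde m,\boldsymbol\theta_m,\tilde{\boldsymbol\theta}_{\tilde m}$. Then the Generalized Multiple-Try Reversible Jump (GMTRJ) algorithm with $k$ trials, as specified in the context, satisfies the detailed balance condition with respect to $\pi$: for all models $m,\tilde m$ and (almost) all $(\boldsymbol\theta_m,\boldsymbol u_{\tilde m})$, with $(\tilde{\boldsymbol\theta}_{\tilde m},\boldsymbol u_m)=g_{m,\tilde m}(\boldsymbol\theta_m,\boldsymbol u_{\tilde m})$ and $(m,\boldsymbol\theta_m)\neq(\tilde m,\tilde{\boldsymbol\theta}_{\tilde m})$, $$\pi(m,\boldsymbol\theta_m)\,P_{m,\tilde m}(\boldsymbol\theta_m,\tilde{\boldsymbol\theta}_{\tilde m})=\pi(\tilde m,\tilde{\boldsymbol\theta}_{\tilde m})\,P_{\tilde m,m}(\tilde{\boldsymbol\theta}_{\tilde m},\boldsymbol\theta_m)\,\bigl|\boldsymbol J(\boldsymbol\theta_m,\boldsymbol u_{\tilde m})\bigr|,$$ where $P_{m,\tilde m}$ denotes the transition density of the algorithm for accepted moves from model $m$ to model $\tilde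 m$ and $|\boldsymbol J(\boldsymbol\theta_m,\boldsymbol u_{\tilde m})|$ is the Jacobian determinant (in absolute value) of $g_{m,\tilde m}$ at $(\boldsymbol\theta_m,\boldsymbol u_{\tilde m})$.
   Context: **Setting.** Model $\mathcal{M}_m$ has parameter space $\boldsymbol\Theta_m$, a subset of a Euclidean space, with elements $\boldsymbol\theta_m$ of dimension $d(\boldsymbol\theta_m)$. $L(\boldsymbol y\mid m,\boldsymbol\theta_m)$ is the likelihood of the observed data $\boldsymbol y$, $p(\boldsymbol\theta_m\mid m)$ is the prior density of the parameters and $p(m)$ is the prior probability of model $\mathcal{M}_m$. All densities are with respect to Lebesgue measure. **Ingredients.** - $h(m,\tilde m)$: the probability of proposing model $\mathcal{M}_{\tilde m}$ when the current model is $\mathcal{M}_m$. - $T_{m,\tilde m}(\boldsymbol\theta_m,\cdot)$: for each $\boldsymbol\theta_m$, a probability density for an auxiliary variable $\boldsymbol u_{\tilde m}$ (identically $1$ if the auxiliary variable has dimension $0$). - $g_{m,\tilde m}$: an invertible, continuously differentiable map (with continuously differentiable inverse) $(\boldsymbol\theta_m,\boldsymbol u_{\tilde m})\mapsto(\tilde{\boldsymbol\theta}_{\tilde m},\boldsymbol u_m)$, satisfying the dimension matching $d(\boldsymbol\theta_m)+d(\boldsymbol u_{\tilde m})=d(\tilde{\boldsymbol\theta}_{\tilde m})+d(\boldsymbol u_m)$, and with $g_{\tilde m,m}=g_{m,\tilde m}^{-1}$. - $|\boldsymbol J(\boldsymbol\theta_m,\boldsymbol u_{\tilde m})|=\left|\frac{\partial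 g_{m,\tilde m}(\boldsymbol\theta_m,\boldsymbol u_{\tilde m})}{\partial(\boldsymbol\theta_m,\boldsymbol u_{\tilde m})}\right|$. **GMTRJ algorithm** (one step from the current state $(m,\boldsymbol\theta_m)$). 1. Select a candidate model $\mathcal{M}_{\tilde m}$ with probability $h(m,\tilde m)$. 2. For $j=1,\ldots,k$, independently generate $\boldsymbol u^{(j)}_{\tilde m}$ from the density $T_{m,\tilde m}(\boldsymbol\theta_m,\cdot)$. 3. For $j=1,\ldots,k$, set $(\tilde{\boldsymbol\theta}^{(j)}_{\tilde m},\boldsymbol u^{(j)}_m)=g_{m,\tilde m}(\boldsymbol\theta_m,\boldsymbol u^{(j)}_{\tilde m})$. 4. Choose one of the $k$ trials, the $j$-th being chosen with probability proportional to $w^*_{m,\tilde m}(\boldsymbol\theta_m,\tilde{\boldsymbol\theta}^{(j)}_{\tilde m})$. Write $\tilde{\boldsymbol\theta}_{\tilde m},\boldsymbol u_{\tilde m},\boldsymbol u_m$ for the quantities of the chosen trial, and $$p_{m,\tilde m}(\boldsymbol\theta_m,\tilde{\boldsymbol\theta}_{\tilde m})=\frac{w^*_{m,\tilde m}(\boldsymbol\theta_m,\tilde{\boldsymbol\theta}_{\tilde m})}{\sum_{j=1}^k w^*_{m,\tilde m}(\boldsymbol\theta_m,\tilde{\boldsymbol\theta}^{(j)}_{\tilde m})}.$$ 5. For $j=1,\ldots,k-1$, independently generate $\bar{\boldsymbol u}^{(j)}_m$ from the density $T_{\tilde m,m}(\tilde{\boldsymbol\theta}_{\tilde m},\cdot)$.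 6. For $j=1,\ldots,k-1$, let $\bar{\boldsymbol\theta}^{(j)}_m$ be the parameter component of $g_{\tilde m,m}(\tilde{\boldsymbol\theta}_{\tilde m},\bar{\boldsymbol u}^{(j)}_m)$; set $\bar{\boldsymbol\theta}^{(k)}_m=\boldsymbol\theta_m$ and $\bar{\boldsymbol u}^{(k)}_m=\boldsymbol u_m$. 7. Define $$p_{\tilde m,m}(\tilde{\boldsymbol\theta}_{\tilde m},\boldsymbol\theta_m)=\frac{w^*_{\tilde m,m}(\tilde{\boldsymbol\theta}_{\tilde m},\boldsymbol\theta_m)}{\sum_{j=1}^k w^*_{\tilde m,m}(\tilde{\boldsymbol\theta}_{\tilde m},\bar{\boldsymbol\theta}^{(j)}_m)}.$$ 8. Accept the move from $(m,\boldsymbol\theta_m)$ to $(\tilde m,\tilde{\boldsymbol\theta}_{\tilde m})$ with probability $$\alpha=\min\left\{1,\frac{\pi(\tilde m,\tilde{\boldsymbol\theta}_{\tilde m})\,h(\tilde m,m)\,T_{\tilde m,m}(\tilde{\boldsymbol\theta}_{\tilde m},\boldsymbol u_m)\,p_{\tilde m,m}(\tilde{\boldsymbol\theta}_{\tilde m},\boldsymbol\theta_m)}{\pi(m,\boldsymbol\theta_m)\,h(m,\tilde m)\,T_{m,\tilde m}(\boldsymbol\theta_m,\boldsymbol u_{\tilde m})\,p_{m,\tilde m}(\boldsymbol\theta_m,\tilde{\boldsymbol\theta}_{\tilde m})}\,|\boldsymbol J(\boldsymbol\theta_m,\boldsymbol u_{\tilde m})|\right\}$$ (with $\alpha=1$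 if the denominator vanishes); otherwise stay at $(m,\boldsymbol\theta_m)$. **Transition density.** $P_{m,\tilde m}(\boldsymbol\theta_m,\tilde{\boldsymbol\theta}_{\tilde m})$ is the density, with respect to Lebesgue measure in the auxiliary variable $\boldsymbol u_{\tilde m}$ associated with the move $(\boldsymbol\theta_m,\boldsymbol u_{\tilde m})\mapsto(\tilde{\boldsymbol\theta}_{\tilde m},\boldsymbol u_m)$, of the event that, starting from $(m,\boldsymbol\theta_m)$, model $\tilde m$ is proposed, the trial chosen in Step 4 has auxiliary variable $\boldsymbol u_{\tilde m}$, and the move is accepted. That is, for every measurable set $B$, the integral over $\boldsymbol u_{\tilde m}\in B$ of this density equals the probability that $\tilde m$ is selected in Step 1, the chosen trial's auxiliary variable lies in $B$, and the move is accepted in Step 8. Likewise, $P_{\tilde m,m}(\tilde{\boldsymbol\theta}_{\tilde m},\boldsymbol\theta_m)$ is the density with respect to $\boldsymbol u_m$ of the corresponding event for the reverse move $(\tilde{\boldsymbol\theta}_{\tilde m},\boldsymbol u_m)\mapsto(\boldsymbol\theta_m,\boldsymbol u_{\tilde m})=g_{\tilde m,m}(\tilde{\boldsymbol\theta}_{\tilde m},\boldsymbol u_m)$. If an auxiliary variable has dimension $0$, the corresponding density is just the probability of the event. All functions involved are assumed jointly measurable. *)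

(* Defs.v *)
From HB Require Import structures.
From mathcomp Require Import all_boot all_order all_algebra.
From mathcomp Require Import all_classical all_reals all_analysis.

Set Implicit Arguments.
Unset Strict Implicit.
Unset Printing Implicit Defensive.

Import Order.TTheory GRing.Theory Num.Theory.
Import numFieldNormedType.Exports.

Local Open Scope classical_set_scope.
Local Open Scope ring_scope.

(* The sigma-algebra generated by the coordinates, i.e. the Borel one. *)
Section rV_measurable.
Context {R : realType}.
Variable n : nat.

Let coors : 'I_n -> 'rV[R]_n -> R := fun i x => x ord0 i.

Let rV_set0 : g_sigma_preimage coors set0.
Proof. exact: sigma_algebra0. Qed.

Let rV_setC A : g_sigma_preimage coors A -> g_sigma_preimage coors (~` A).
Proof. exact: sigma_algebraC. Qed.

Let rV_bigcup (F : _^nat) : (forall i, g_sigma_preimage coors (F i)) ->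
  g_sigma_preimage coors (\bigcup_i (F i)).
Proof. exact: sigma_algebra_bigcup. Qed.

HB.instance Definition _ := @isMeasurable.Build default_measure_display
  'rV[R]_n (g_sigma_preimage coors) rV_set0 rV_setC rV_bigcup.

End rV_measurable.

Section rV_measurable_lemmas.
Context d (T : measurableType d) (R : realType).

Lemma measurable_rV_coord n (i : 'I_n) :
  measurable_fun [set: 'rV[R]_n] (fun x : 'rV[R]_n => x ord0 i).
Proof.
move=> _ Y mY; rewrite setTI; apply: sub_sigma_algebra => /=.
rewrite -bigcup_seq/=; exists i => /=; first by rewrite mem_index_enum.
by exists Y => //; rewrite setTI.
Qed.

Lemma measurable_fun_rVP n (f : T -> 'rV[R]_n) :
  (forall i, measurable_fun [set: T] (fun x => f x ord0 i)) ->
  measurable_fun [set: T] f.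
Proof.
move=> mf.
have: g_sigma_preimage (fun i x => f x ord0 i) `<=` measurable.
  apply: smallest_sub; first exact: sigma_algebra_measurable.
  rewrite -bigcup_seq/=; apply: bigcup_sub => i _ A [B mB <-]; exact: mf.
rewrite (g_sigma_preimage_comp (fun i (x : 'rV[R]_n) => x ord0 i) f) => prefS.
by move=> _ A mA; apply: prefS; exists A.
Qed.

End rV_measurable_lemmas.

Section pushforward_sigma_finite.
Local Open Scope ereal_scope.
Context d1 d2 (T1 : measurableType d1) (T2 : measurableType d2) (R : realType).
Variables (m : {measure set T1 -> \bar R}).
Hypothesis m_sigma_finite : sigma_finite setT m.
Variables (f : T1 -> T2) (g : T2 -> T1).
Hypotheses (mf : measurable_fun setT f) (mg : measurable_fun setT g).
Hypothesis fK : cancel f g.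

Let P := pushforward m f.

Let P0 : P set0 = 0. Proof. exact: measure0. Qed.

Let P_ge0 A : 0 <= P A. Proof. exact: measure_ge0. Qed.

Let P_sigma_additive : semi_sigma_additive P.
Proof.
move=> G mG tG mUG; rewrite /P /pushforward preimage_bigcup.
apply: measure_semi_sigma_additive.
- by move=> i; rewrite -[X in measurable X]setTI; exact: mf.
- apply/trivIsetP => i j _ _ ij; rewrite -preimage_setI.
  by move/trivIsetP : tG => /(_ _ _ Logic.I Logic.I ij) ->; rewrite preimage_set0.
- by rewrite -preimage_bigcup -[X in measurable X]setTI; exact: mf.
Qed.

HB.instance Definition _ := isMeasure.Build _ _ _ P P0 P_ge0 P_sigma_additive.

Let P_sigma_finite : sigma_finite setT P.
Proof.
have [F UF Foo] := m_sigma_finite.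
exists (fun i => g @^-1` F i).
  by rewrite -preimage_bigcup -UF preimage_setT.
move=> i; have [mFi Fi] := Foo i; split.
  by rewrite -[X in measurable X]setTI; exact: mg.
by rewrite /P /pushforward -comp_preimage (_ : g \o f = id)//; exact/funext.
Qed.

HB.instance Definition _ := Measure_isSigmaFinite.Build _ _ _ P P_sigma_finite.

Lemma pushforward_sigma_finite :
  {nu : {sigma_finite_measure set T2 -> \bar R} |
    nu = pushforward m f :> (set T2 -> \bar R)}.
Proof. by exists (P : {sigma_finite_measure set T2 -> \bar R}). Qed.

End pushforward_sigma_finite.

Lemma dirac_sigma_finite d (T : measurableType d) (R : realType) (a : T) :
  sigma_finite [set: T] (@dirac _ T a R).
Proof.
exists (fun=> setT); first by rewrite bigcup_const.
by move=> _; split => //; rewrite diracT ltry.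
Qed.

(* The n-fold product of mu with itself. *)
Fixpoint tuple_measure d (T : measurableType d) (R : realType)
    (mu : set T -> \bar R) (n : nat) : set (n.-tuple T) -> \bar R :=
  match n return set (n.-tuple T) -> \bar R with
  | 0 => dirac [tuple]
  | n'.+1 => pushforward (mu \x @tuple_measure d T R mu n')%E
      (fun x : T * n'.-tuple T => [the n'.+1.-tuple T of x.1 :: x.2])
  end.
Arguments tuple_measure {d T R} mu n _.

Section tuple_measure_instances.
Local Open Scope ereal_scope.
Context d (T : measurableType d) (R : realType).
Variable mu : {sigma_finite_measure set T -> \bar R}.

Lemma tuple_measure_sigma_finite n :
  {nu : {sigma_finite_measure set (n.-tuple T) -> \bar R} |
    nu = tuple_measure mu n :> (set (n.-tuple T) -> \bar R)}.
Proof.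
elim: n => [|n [nu nuE]].
  pose sf := Measure_isSigmaFinite.Build _ _ _
    (@dirac _ (0.-tuple T) [tuple] R) (dirac_sigma_finite _ _).
  pose m0 : {sigma_finite_measure set (0.-tuple T) -> \bar R} :=
    HB.pack (@dirac _ (0.-tuple T) [tuple] R) sf.
  by exists m0.
pose f := fun x : T * n.-tuple T => [the n.+1.-tuple T of x.1 :: x.2].
pose g := fun t : n.+1.-tuple T => (thead t, [tuple of behead t]).
have mf : measurable_fun setT f by exact: measurable_cons.
have mg : measurable_fun setT g.
  apply: measurable_fun_pair; first exact: measurable_tnth.
  exact: measurable_behead.
have fK : cancel f g by move=> [a t]; congr (_, _); exact: val_inj.
(* (mu \x nu) is sigma-finite in the library, but its canonical instance is
   hidden by the one for products of subprobabilities *)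
have sf : sigma_finite setT (mu \x nu) := isSigmaFinite.sigma_finiteT
  (lebesgue_integral_fubini.measure_function_Measure_isSigmaFinite__to__measure_function_isSigmaFinite
    mu nu).
have [nu' nu'E] := pushforward_sigma_finite sf mf mg fK.
by exists nu'; rewrite nu'E /= -nuE.
Qed.

Let tm0 n : tuple_measure mu n set0 = 0.
Proof. by have [nu <-] := tuple_measure_sigma_finite n; exact: measure0. Qed.

Let tm_ge0 n A : 0 <= tuple_measure mu n A.
Proof. by have [nu <-] := tuple_measure_sigma_finite n; exact: measure_ge0. Qed.

Let tm_sigma_additive n : semi_sigma_additive (tuple_measure mu n).
Proof.
have [nu <-] := tuple_measure_sigma_finite n.
exact: measure_semi_sigma_additive.
Qed.

HB.instance Definition _ n := isMeasure.Build _ _ _ (tuple_measure mu n)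
  (tm0 n) (@tm_ge0 n) (@tm_sigma_additive n).

Let tm_sigma_finite n : sigma_finite setT (tuple_measure mu n).
Proof.
by have [nu <-] := tuple_measure_sigma_finite n; exact: sigma_finiteT.
Qed.

HB.instance Definition _ n := Measure_isSigmaFinite.Build _ _ _
  (tuple_measure mu n) (@tm_sigma_finite n).

End tuple_measure_instances.

Section lebesgue_rV.
Local Open Scope ereal_scope.
Variable R : realType.

Definition lebesgue_rV n : set 'rV[R]_n -> \bar R :=
  pushforward (tuple_measure (@lebesgue_measure R) n)
    (fun t : n.-tuple R => (\row_i tnth t i)%R).

Lemma lebesgue_rV_sigma_finite n :
  {nu : {sigma_finite_measure set 'rV[R]_n -> \bar R} |
    nu = @lebesgue_rV n :> (set 'rV[R]_n -> \bar R)}.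
Proof.
pose f := fun t : n.-tuple R => (\row_i tnth t i)%R.
pose g := fun x : 'rV[R]_n => [tuple x ord0 i | i < n].
have mf : measurable_fun setT f.
  apply: measurable_fun_rVP => i.
  rewrite (_ : (fun _ => _) = @tnth n R ^~ i); last first.
    by apply/funext => t; rewrite mxE.
  exact: measurable_tnth.
have mg : measurable_fun setT g.
  apply/measurable_fun_tnthP => i.
  rewrite (_ : _ \o _ = fun x : 'rV[R]_n => x ord0 i); last first.
    by apply/funext => t /=; rewrite tnth_mktuple.
  exact: measurable_rV_coord.
have fK : cancel f g.
  by move=> t; apply: eq_from_tnth => i; rewrite tnth_mktuple mxE.
exact: (pushforward_sigma_finite (sigma_finiteT
  (tuple_measure (@lebesgue_measure R) n)) mf mg fK).
Qed.

Let leb0 n : @lebesgue_rV n set0 = 0.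
Proof. by have [nu <-] := lebesgue_rV_sigma_finite n; exact: measure0. Qed.

Let leb_ge0 n A : 0 <= @lebesgue_rV n A.
Proof. by have [nu <-] := lebesgue_rV_sigma_finite n; exact: measure_ge0. Qed.

Let leb_sigma_additive n : semi_sigma_additive (@lebesgue_rV n).
Proof.
have [nu <-] := lebesgue_rV_sigma_finite n.
exact: measure_semi_sigma_additive.
Qed.

HB.instance Definition _ n := isMeasure.Build _ _ _ (@lebesgue_rV n)
  (leb0 n) (@leb_ge0 n) (@leb_sigma_additive n).

Let leb_sigma_finite n : sigma_finite setT (@lebesgue_rV n).
Proof.
by have [nu <-] := lebesgue_rV_sigma_finite n; exact: sigma_finiteT.
Qed.

HB.instance Definition _ n := Measure_isSigmaFinite.Build _ _ _
  (@lebesgue_rV n) (@leb_sigma_finite n).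

End lebesgue_rV.
Arguments lebesgue_rV {R} n _.

(* Models are indexed by 'I_M. The auxiliary variable used when moving from
   model m to model m' lives in R^(adim m m'), and a pair (theta, u) is encoded
   as the row vector row_mx theta u. [supp m m'] is the set of pairs on which
   [jump m m'] acts as the bijection g_{m,m'} (all of Theta_m x R^(adim m m')
   when the auxiliary variable is unrestricted). *)
Record sampler (R : realType) (Y : Type) (M : nat) := Sampler {
  pdim : 'I_M -> nat;
  adim : 'I_M -> 'I_M -> nat;
  dim_matching : forall m m',
    (pdim m + adim m m' = pdim m' + adim m' m)%N;
  Theta : forall m, set 'rV[R]_(pdim m);
  likelihood : Y -> forall m, 'rV[R]_(pdim m) -> R;
  prior : forall m, 'rV[R]_(pdim m) -> R;
  model_prior : 'I_M -> R;
  propose : 'I_M -> 'I_M -> R;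
  supp : forall m m', set 'rV[R]_(pdim m + adim m m');
  aux_density : forall m m', 'rV[R]_(pdim m) -> 'rV[R]_(adim m m') -> R;
  jump : forall m m',
    'rV[R]_(pdim m + adim m m') -> 'rV[R]_(pdim m' + adim m' m);
  weight : forall m m', 'rV[R]_(pdim m) -> 'rV[R]_(pdim m') -> R
}.

Arguments Theta {R Y M} s m _.
Arguments likelihood {R Y M} s y {m} _.
Arguments prior {R Y M} s {m} _.
Arguments supp {R Y M} s m m' _.
Arguments aux_density {R Y M} s {m} m' _ _.
Arguments jump {R Y M} s m m' _.
Arguments weight {R Y M} s {m m'} _ _.

Definition C1_on (R : realType) (n p : nat) (O : set 'rV[R]_n)
    (f : 'rV[R]_n -> 'rV[R]_p) : Prop :=
  open O /\ forall x, O x -> differentiable f x /\ {for x, continuous (jacobian f)}.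

Section GMTRJ.
Context {R : realType} {Y : Type} {M : nat}.
Variables (A : sampler R Y M) (y : Y) (k : nat).

Notation par m := 'rV[R]_(pdim A m).
Notation aux m m' := 'rV[R]_(adim A m m').

Definition target m (theta : par m) : R :=
  likelihood A y theta * prior A theta * model_prior A m.

Record sampler_spec : Prop := SamplerSpec {
  Theta_measurable : forall m, measurable (Theta A m);
  likelihood_ge0 : forall m (theta : par m),
    Theta A m theta -> 0 <= likelihood A y theta;
  likelihood_measurable : forall m,
    measurable_fun (Theta A m) (likelihood A y (m := m));
  prior_ge0 : forall m (theta : par m), Theta A m theta -> 0 <= prior A theta;
  prior_measurable : forall m,
    measurable_fun (Theta A m) (prior A (m := m));
  prior_int1 : forall m,
    (\int[lebesgue_rV (pdim A m)]_(theta in Theta A m)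
       (prior A theta)%:E = 1)%E;
  model_prior_ge0 : forall m, 0 <= model_prior A m;
  model_prior_sum1 : \sum_m model_prior A m = 1;
  propose_ge0 : forall m m', 0 <= propose A m m';
  propose_sum1 : forall m, \sum_m' propose A m m' = 1;
  supp_measurable : forall m m', measurable (supp A m m');
  supp_Theta : forall m m' x, supp A m m' x -> Theta A m (lsubmx x);
  aux_density_ge0 : forall m m' (theta : par m) (u : aux m m'),
    Theta A m theta -> 0 <= aux_density A m' theta u;
  aux_density_supp : forall m m' (theta : par m) (u : aux m m'),
    Theta A m theta -> ~ supp A m m' (row_mx theta u) -> aux_density A m' theta u = 0;
  aux_density_int1 : forall m m' (theta : par m), Theta A m theta ->
    (\int[lebesgue_rV (adim A m m')]_u
       (aux_density A m' theta u)%:E = 1)%E;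
  aux_density_measurable : forall m m',
    measurable_fun (Theta A m `*` [set: aux m m'])
      (fun z : par m * aux m m' => aux_density A m' z.1 z.2);
  weight_gt0 : forall m m' (theta : par m) (theta' : par m'),
    Theta A m theta -> Theta A m' theta' -> 0 < weight A theta theta';
  weight_measurable : forall m m',
    measurable_fun (Theta A m `*` Theta A m')
      (fun z : par m * par m' => weight A z.1 z.2);
  (* g_{m,m'} and g_{m',m} extend to mutually inverse C1 maps between open
     neighbourhoods of their domains, which need not be open themselves *)
  jump_C1 : exists O : forall m m', set 'rV[R]_(pdim A m + adim A m m'),
    forall m m',
    [/\ supp A m m' `<=` O m m',
        C1_on (O m m') (jump A m m') &
        forall x, O m m' x ->
          O m' m (jump A m m' x) /\ jump A m' m (jump A m m' x) = x];
  jump_supp : forall m m' x,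
    supp A m m' x -> supp A m' m (jump A m m' x)
}.

Definition abs_jacobian m m' (x : 'rV[R]_(pdim A m + adim A m m')) : R :=
  `|\det (castmx (erefl, esym (dim_matching A m m'))
      (jacobian (jump A m m') x))|.

Definition new_par m m' (theta : par m) (u : aux m m') : par m' :=
  lsubmx (jump A m m' (row_mx theta u)).

Definition new_aux m m' (theta : par m) (u : aux m m') : aux m' m :=
  rsubmx (jump A m m' (row_mx theta u)).

Definition select_prob m m' (theta : par m) (us : k.-tuple (aux m m'))
    (j : 'I_k) : R :=
  weight A theta (new_par theta (tnth us j)) /
  \sum_(i < k) weight A theta (new_par theta (tnth us i)).

(* Selection probability of theta among the k.-1 reverse trials generated from
   vs together with the k-th one, theta itself. *)
Definition reverse_select_prob m m' (theta' : par m') (theta : par m)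
    (vs : k.-1.-tuple (aux m' m)) : R :=
  weight A theta' theta /
  (\sum_(i < k.-1) weight A theta' (new_par theta' (tnth vs i) : par m) +
   weight A theta' theta).

Definition accept_prob m m' (theta : par m) (us : k.-tuple (aux m m'))
    (j : 'I_k) (vs : k.-1.-tuple (aux m' m)) : R :=
  let u := tnth us j in
  let theta' := new_par theta u in
  let u' := new_aux theta u in
  let num := target theta' * propose A m' m * aux_density A m theta' u' *
    reverse_select_prob theta' theta vs in
  let den := target theta * propose A m m' * aux_density A m' theta u *
    select_prob theta us j in
  if den == 0 then 1
  else Num.min 1 (num / den * abs_jacobian (row_mx theta u)).

(* Expectation of F under n independent draws from the density f. *)
Definition expect_iid r n (f : 'rV[R]_r -> R) (F : n.-tuple 'rV[R]_r -> \bar R) :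
    \bar R :=
  (\int[tuple_measure (lebesgue_rV r) n]_us
    ((\prod_(i < n) f (tnth us i))%:E * F us))%E.

(* Probability that, from (m, theta), model m' is proposed, the auxiliary
   variable of the selected trial lies in B, and the move is accepted. *)
Definition move_prob m m' (theta : par m) (B : set (aux m m')) : \bar R :=
  ((propose A m m')%:E *
   expect_iid (aux_density A m' theta) (fun us : k.-tuple (aux m m') =>
     \sum_(j < k) (select_prob theta us j)%:E * (\1_B (tnth us j))%:E *
       expect_iid (aux_density A m (new_par theta (tnth us j)))
         (fun vs : k.-1.-tuple (aux m' m) => (accept_prob theta us j vs)%:E)))%E.

Definition transition_density
    (P : forall m m', par m -> aux m m' -> R) : Prop :=
  forall m m',
  measurable_fun (Theta A m `*` [set: aux m m'])
    (fun z : par m * aux m m' => P m m' z.1 z.2) /\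
  forall theta : par m, Theta A m theta ->
    (forall u, 0 <= P m m' theta u) /\
    (forall B, measurable B ->
      (\int[lebesgue_rV (adim A m m')]_(u in B) (P m m' theta u)%:E =
       move_prob theta B)%E).

End GMTRJ.

Arguments target {R Y M} A y {m} theta.
Arguments abs_jacobian {R Y M} A {m m'} x.
Arguments move_prob {R Y M} A y k {m} m' theta B.
Arguments transition_density {R Y M} A y k P.

(* Main.v *)
(* Let g be the jump from m to m' and x = (theta, u). By exchangeability of the
   trials, a version of P_{m,m'} is
     Q(x) = k h(m,m') T(x) E[p(x, us) alpha(x, us, vs)],
   where us are the k-1 other trials and vs the k-1 reverse ones. Since
   a min(1, (b / a) J) = min(a, b J), the integrand of pi(x) Q(x) is
     k T(us) T'(vs) min(pi h T p (x, us), (pi h T p)(g x, vs) |J(x)|),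
   which the reverse move sends to itself, up to |J(x)|, because g^-1 has
   Jacobian 1 / J(x). This gives the balance equation for Q at every point.
   For a fixed theta, P = Q at almost every u, hence almost everywhere. The
   reverse density P_{m',m} is evaluated at g x, so the points where it differs
   from its version have to be pulled back: they are the image under g^-1 of a
   null set, and a differentiable map between spaces of equal dimension sends
   null sets to null sets. *)

Require Import Defs.
From HB Require Import structures.
From mathcomp Require Import all_boot all_order all_algebra.
From mathcomp Require Import all_classical all_reals all_analysis.
From mathcomp Require Import measurable_realfun ring lra.
Import Order.TTheory GRing.Theory Num.Theory.
Import numFieldNormedType.Exports.

Set Implicit Arguments.
Unset Strict Implicit.
Unset Printing Implicit Defensive.

Local Open Scope classical_set_scope.
Local Open Scope ring_scope.

(** * Iterated integrals over tuples and row vectors *)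

Section tuple_integral.
Local Open Scope ereal_scope.
Context d (T : measurableType d) (R : realType).
Variable mu : {sigma_finite_measure set T -> \bar R}.
Implicit Types n : nat.

Lemma ge0_integral_tuple_measureS n (F : n.+1.-tuple T -> \bar R) :
  measurable_fun [set: n.+1.-tuple T] F -> (forall t, 0 <= F t) ->
  \int[tuple_measure mu n.+1]_t F t =
  \int[mu]_u \int[tuple_measure mu n]_us F [the n.+1.-tuple T of u :: us].
Proof.
move=> mF F0.
pose phi (x : T * n.-tuple T) := [the n.+1.-tuple T of x.1 :: x.2].
have mphi : measurable_fun setT phi by exact: measurable_cons.
rewrite (_ : \int[_]_t F t =
    \int[pushforward (mu \x tuple_measure mu n) phi]_t F t)//.
rewrite ge0_integral_pushforward// fubini_tonelli1//=.
exact: measurableT_comp.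
Qed.

Lemma measurable_ge0_integral_tuple d' (S : measurableType d') n
    (F : S * n.-tuple T -> \bar R) :
  measurable_fun setT F -> (forall t, 0 <= F t) ->
  measurable_fun setT (fun s => \int[tuple_measure mu n]_us F (s, us)).
Proof. by move=> mF F0; exact: measurable_fun_fubini_tonelli_F. Qed.

(** Isolates the trial at position [j]: [lift j] enumerates the other positions in order, so [us]
    lists the remaining trials. *)
Definition tinsert n (j : 'I_n.+1) (u : T) (us : n.-tuple T) : n.+1.-tuple T :=
  [tuple if unlift j i is Some i' then tnth us i' else u | i < n.+1].

Lemma tnth_tinsert n (j : 'I_n.+1) u us : tnth (tinsert j u us) j = u.
Proof. by rewrite tnth_mktuple unlift_none. Qed.

Lemma tnth_tinsert_lift n (j : 'I_n.+1) u us i :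
  tnth (tinsert j u us) (lift j i) = tnth us i.
Proof. by rewrite tnth_mktuple liftK. Qed.

Lemma tinsert0 n u (us : n.-tuple T) : tinsert ord0 u us = [the n.+1.-tuple T of u :: us].
Proof.
apply: eq_from_tnth => i; case: (unliftP ord0 i) => [i' ->|->].
  by rewrite tnth_tinsert_lift tnthS.
by rewrite tnth_tinsert tnth0.
Qed.

Lemma tinsertS n (j : 'I_n.+1) u u0 (us : n.-tuple T) :
  tinsert (lift ord0 j) u [the n.+1.-tuple T of u0 :: us] =
  [the n.+2.-tuple T of u0 :: tinsert j u us].
Proof.
apply: eq_from_tnth => i; case: (unliftP ord0 i) => [i' ->|->]; last first.
  rewrite tnth0.
  have -> : ord0 = lift (lift ord0 j) ord0 :> 'I_n.+2 by exact: val_inj.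
  by rewrite tnth_tinsert_lift tnth0.
rewrite tnthS; case: (unliftP j i') => [i'' ->|->]; last first.
  by rewrite !tnth_tinsert.
rewrite tnth_tinsert_lift.
have -> : lift ord0 (lift j i'') = lift (lift ord0 j) (lift ord0 i'').
  by apply: val_inj => /=; rewrite /bump !leq0n !add1n ltnS addnS.
by rewrite tnth_tinsert_lift tnthS.
Qed.

Definition tremove n (j : 'I_n.+1) (t : n.+1.-tuple T) : n.-tuple T :=
  [tuple tnth t (lift j i) | i < n].

Lemma tinsertK n (j : 'I_n.+1) u (us : n.-tuple T) : tremove j (tinsert j u us) = us.
Proof. by apply: eq_from_tnth => i; rewrite tnth_mktuple tnth_tinsert_lift. Qed.

Lemma tremoveK n (j : 'I_n.+1) t : tinsert j (tnth t j) (tremove j t) = t.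
Proof.
apply: eq_from_tnth => i; case: (unliftP j i) => [i' ->|->].
  by rewrite tnth_tinsert_lift tnth_mktuple.
by rewrite tnth_tinsert.
Qed.

Lemma measurable_tremove n (j : 'I_n.+1) :
  measurable_fun [set: n.+1.-tuple T] (@tremove n j).
Proof.
apply/measurable_fun_tnthP => i; rewrite /comp.
under eq_fun do rewrite tnth_mktuple.
exact: measurable_tnth.
Qed.

Lemma measurable_tinsert d' (S : measurableType d') n (j : 'I_n.+1)
    (f : S -> T) (g : S -> n.-tuple T) :
  measurable_fun setT f -> measurable_fun setT g ->
  measurable_fun setT (fun s => tinsert j (f s) (g s)).
Proof.
move=> mf mg; apply/measurable_fun_tnthP => i /=.
rewrite /comp; case: (unliftP j i) => [i' ->|->].
  under eq_fun do rewrite tnth_tinsert_lift.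
  exact: (measurableT_comp (measurable_tnth _)).
by under eq_fun do rewrite tnth_tinsert.
Qed.

(** Exchangeability of independent draws: any coordinate can be integrated first. The induction
    peels off the head of the tuple, and Tonelli's theorem moves the inserted coordinate in front of
    it. *)
Lemma ge0_integral_tuple_tinsert n (j : 'I_n.+1) (F : n.+1.-tuple T -> \bar R) :
  measurable_fun [set: n.+1.-tuple T] F -> (forall t, 0 <= F t) ->
  \int[tuple_measure mu n.+1]_t F t =
  \int[mu]_u \int[tuple_measure mu n]_us F (tinsert j u us).
Proof.
elim: n j F => [|n IH] j F mF F0.
  rewrite (ge0_integral_tuple_measureS mF F0); apply: eq_integral => u _.
  by apply: eq_integral => us _; rewrite (ord1 j) tinsert0.
case: (unliftP ord0 j) => [j' ->|->]; last first.
  rewrite (ge0_integral_tuple_measureS mF F0); apply: eq_integral => u _.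
  by apply: eq_integral => us _; rewrite tinsert0.
rewrite (ge0_integral_tuple_measureS mF F0).
(* Only the head [x.1] and the inserted coordinate [x.2] are kept free; their integrals are the two
   that get exchanged. *)
pose G (x : T * T) : \bar R := \int[tuple_measure mu n]_us
  F [the n.+2.-tuple T of x.1 :: tinsert j' x.2 us].
have mG : measurable_fun setT G.
  pose H (z : (T * T) * n.-tuple T) :=
    F [the n.+2.-tuple T of z.1.1 :: tinsert j' z.1.2 z.2].
  apply: (@measurable_ge0_integral_tuple _ _ _ H); last by move=> z; exact: F0.
  apply: measurableT_comp; first exact: mF.
  apply: measurable_cons.
    exact: (measurableT_comp measurable_fst measurable_fst).
  apply: measurable_tinsert; last exact: measurable_snd.
  exact: (measurableT_comp measurable_snd measurable_fst).
transitivity (\int[mu]_u0 \int[mu]_u G (u0, u)).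
  apply: eq_integral => u0 _; rewrite (IH j')//.
  by apply: measurableT_comp => //; exact: measurable_cons.
have G0 x : 0 <= G x by exact: integral_ge0.
rewrite -fubini_tonelli1// fubini_tonelli2//; apply: eq_integral => u _.
have mFj : measurable_fun [set: n.+1.-tuple T]
    (fun us => F (tinsert (lift ord0 j') u us)).
  by apply: measurableT_comp; [exact: mF|exact: measurable_tinsert].
rewrite (ge0_integral_tuple_measureS mFj (fun=> F0 _)).
by apply: eq_integral => u0 _; apply: eq_integral => us _; rewrite tinsertS.
Qed.

Lemma measurable_cat_tuple n1 n2 :
  measurable_fun setT
    (fun z : n1.-tuple T * n2.-tuple T => [the (n1 + n2).-tuple T of z.1 ++ z.2]).
Proof.
apply/measurable_fun_tnthP => i; rewrite /comp.
case: (split_ordP i) => j ->.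
  under eq_fun do rewrite tnth_lshift.
  exact: (measurableT_comp (measurable_tnth _)).
under eq_fun do rewrite tnth_rshift.
exact: (measurableT_comp (measurable_tnth _)).
Qed.

(** Splits a product measure into two blocks, which yields Lebesgue measure on pairs [row_mx x y] as
    an iterated integral. *)
Lemma ge0_integral_tuple_cat n1 n2 (F : (n1 + n2).-tuple T -> \bar R) :
  measurable_fun [set: (n1 + n2).-tuple T] F -> (forall t, 0 <= F t) ->
  \int[tuple_measure mu (n1 + n2)]_t F t =
  \int[tuple_measure mu n1]_s \int[tuple_measure mu n2]_t
    F [the (n1 + n2).-tuple T of s ++ t].
Proof.
have mcat n (G : (n + n2).-tuple T -> \bar R) :
    measurable_fun [set: (n + n2).-tuple T] G -> (forall t, 0 <= G t) ->
    measurable_fun [set: n.-tuple T] (fun s => \int[tuple_measure mu n2]_t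
      G [the (n + n2).-tuple T of s ++ t]).
  move=> mG G0.
  pose H (z : n.-tuple T * n2.-tuple T) := G [the (n + n2).-tuple T of z.1 ++ z.2].
  apply: (@measurable_ge0_integral_tuple _ _ _ H); last by move=> z; exact: G0.
  by apply: measurableT_comp; [exact: mG|exact: measurable_cat_tuple].
elim: n1 F => [|n IH] F mF F0.
  rewrite (_ : \int[tuple_measure mu 0]_s _ = \int[dirac [tuple]]_s
    \int[tuple_measure mu n2]_t F [the (0 + n2).-tuple T of s ++ t])//.
  rewrite integral_dirac//; last exact: mcat.
  rewrite diracT mul1e; apply: eq_integral => t _; congr (F _).
  exact: val_inj.
rewrite (ge0_integral_tuple_measureS mF F0).
rewrite (ge0_integral_tuple_measureS (mcat _ _ mF F0)); last first.
  by move=> t; exact: integral_ge0.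
apply: eq_integral => u _.
rewrite (IH (fun us => F [the (n + n2).+1.-tuple T of u :: us])).
- apply: eq_integral => s _; apply: eq_integral => t _; congr (F _).
  exact: val_inj.
- by apply: measurableT_comp; [exact: mF|exact: measurable_cons].
- by move=> ?; exact: F0.
Qed.

End tuple_integral.

(** * Lebesgue measure on row vectors: boxes and iterated integrals *)

Section lebesgue_rV_integral.
Local Open Scope ereal_scope.
Context (R : realType).

Lemma tuple_measure_box d (T : measurableType d)
    (mu : {sigma_finite_measure set T -> \bar R}) n (B : 'I_n -> set T) :
  (forall i, measurable (B i)) ->
  tuple_measure mu n [set t | forall i, B i (tnth t i)] = \prod_(i < n) mu (B i).
Proof.
elim: n B => [|n IH] B mB.
  rewrite big_ord0 /= diracE mem_set// => i; by case: i.
rewrite big_ord_recl -IH => [|i]; last exact: mB.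
have mI : measurable [set t : n.-tuple T | forall i, B (lift ord0 i) (tnth t i)].
  rewrite (_ : mkset _ = \bigcap_i ((fun t => tnth t i) @^-1` B (lift ord0 i))).
    apply: fin_bigcap_measurable => // i _; rewrite -[X in measurable X]setTI.
    by apply: measurable_tnth => //; exact: mB.
  by apply/seteqP; split=> t /= h i; [move=> _; exact: h|exact: h].
rewrite -(product_measure1E _ _ (mB ord0) mI)/= /pushforward; congr (_ _).
apply/seteqP; split => -[a t] /= h; first split.
- by have := h ord0; rewrite tnth0.
- by move=> i; have := h (lift ord0 i); rewrite tnthS.
- move=> i; case: (unliftP ord0 i) => [i' ->|->]; first by rewrite tnthS; exact: h.2.
  by rewrite tnth0; exact: h.1.
Qed.

Lemma measurable_row_tnth n :
  measurable_fun [set: n.-tuple R] (fun t => (\row_i tnth t i)%R : 'rV[R]_n).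
Proof.
apply: measurable_fun_rVP => i; under eq_fun do rewrite mxE.
exact: measurable_tnth.
Qed.

Lemma ge0_integral_lebesgue_rV n (F : 'rV[R]_n -> \bar R) :
  measurable_fun [set: 'rV[R]_n] F -> (forall x, 0 <= F x) ->
  \int[lebesgue_rV n]_x F x =
  \int[tuple_measure (@lebesgue_measure R) n]_t F (\row_i tnth t i)%R.
Proof.
move=> mF F0; pose phi (t : n.-tuple R) := (\row_i tnth t i)%R : 'rV[R]_n.
have mphi : measurable_fun [set: n.-tuple R] phi by exact: measurable_row_tnth.
rewrite (_ : \int[_]_x F x =
  \int[pushforward (tuple_measure (@lebesgue_measure R) n) phi]_x F x)//.
by rewrite ge0_integral_pushforward.
Qed.

Lemma measurable_row_mx d (T : measurableType d) n1 n2
    (f : T -> 'rV[R]_n1) (g : T -> 'rV[R]_n2) :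
  measurable_fun setT f -> measurable_fun setT g ->
  measurable_fun setT (fun z => row_mx (f z) (g z)).
Proof.
move=> mf mg; apply: measurable_fun_rVP => i.
case: (split_ordP i) => j ->.
  under eq_fun do rewrite row_mxEl.
  exact: (measurableT_comp (measurable_rV_coord _)).
under eq_fun do rewrite row_mxEr.
exact: (measurableT_comp (measurable_rV_coord _)).
Qed.

Lemma measurable_lsubmx n1 n2 :
  measurable_fun [set: 'rV[R]_(n1 + n2)] (@lsubmx R 1 n1 n2).
Proof.
apply: measurable_fun_rVP => i; under eq_fun do rewrite mxE.
exact: measurable_rV_coord.
Qed.

Lemma measurable_rsubmx n1 n2 :
  measurable_fun [set: 'rV[R]_(n1 + n2)] (@rsubmx R 1 n1 n2).
Proof.
apply: measurable_fun_rVP => i; under eq_fun do rewrite mxE.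
exact: measurable_rV_coord.
Qed.

(** Tonelli's theorem for pairs encoded as row vectors. It turns nullity of the sections at fixed
    [theta] into nullity in the joint space. *)
Lemma ge0_integral_lebesgue_row_mx n1 n2 (F : 'rV[R]_(n1 + n2) -> \bar R) :
  measurable_fun [set: 'rV[R]_(n1 + n2)] F -> (forall x, 0 <= F x) ->
  \int[lebesgue_rV (n1 + n2)]_x F x =
  \int[lebesgue_rV n1]_x \int[lebesgue_rV n2]_y F (row_mx x y).
Proof.
move=> mF F0.
pose G (z : 'rV[R]_n1 * 'rV[R]_n2) := F (row_mx z.1 z.2).
have mG : measurable_fun setT G.
  apply: measurableT_comp; first exact: mF.
  by apply: measurable_row_mx; [exact: measurable_fst|exact: measurable_snd].
have mFr (n : nat) (H : 'rV[R]_n -> \bar R) : measurable_fun [set: 'rV[R]_n] H ->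
    measurable_fun [set: n.-tuple R] (fun t => H (\row_i tnth t i)%R).
  by move=> mH; apply: (measurableT_comp mH); exact: measurable_row_tnth.
rewrite (ge0_integral_lebesgue_rV mF F0) ge0_integral_tuple_cat; last 2 first.
- exact: mFr.
- by move=> ?; exact: F0.
rewrite [RHS]ge0_integral_lebesgue_rV; last 2 first.
- apply: (@measurable_fun_fubini_tonelli_F _ _ _ _ _ (lebesgue_rV n2) G) => // z.
  exact: F0.
- by move=> x; apply: integral_ge0 => y _; exact: F0.
apply: eq_integral => s _.
rewrite [RHS]ge0_integral_lebesgue_rV; last 2 first.
- exact: (measurable_fun_pair2 _ mG).
- by move=> ?; exact: F0.
apply: eq_integral => t _; congr (F _); apply/rowP => i; rewrite mxE.
case: (split_ordP i) => j ->.
  by rewrite tnth_lshift row_mxEl mxE.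
by rewrite tnth_rshift row_mxEr mxE.
Qed.

Lemma lebesgue_rV_box n (B : 'I_n -> set R) : (forall i, measurable (B i)) ->
  lebesgue_rV n [set x | forall i, B i (x ord0 i)] =
  \prod_(i < n) lebesgue_measure (B i).
Proof.
move=> mB; transitivity (tuple_measure (@lebesgue_measure R) n
    [set t | forall i, B i (tnth t i)]); last exact: tuple_measure_box.
rewrite /lebesgue_rV /pushforward; congr (tuple_measure _ _ _).
by apply/seteqP; split=> t /= h i; have := h i; rewrite mxE.
Qed.

Lemma measurable_rV_box n (B : 'I_n -> set R) : (forall i, measurable (B i)) ->
  measurable [set x : 'rV[R]_n | forall i, B i (x ord0 i)].
Proof.
move=> mB.
rewrite (_ : mkset _ = \bigcap_i ((fun x : 'rV[R]_n => x ord0 i) @^-1` B i)).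
  apply: fin_bigcap_measurable => // i _; rewrite -[X in measurable X]setTI.
  by apply: measurable_rV_coord => //; exact: mB.
by apply/seteqP; split=> t /= h i; [move=> _; exact: h|exact: h].
Qed.

End lebesgue_rV_integral.

(** * Dyadic sets *)

Section dyadic.
Context (R : realType).

Lemma exists_expr2V_lt (e : R) : 0 < e -> exists l, (2 ^+ l)^-1 < e.
Proof.
move=> e0; exists (Num.bound e^-1).
by rewrite invf_plt ?posrE ?exprn_gt0//; exact: upper_nthrootP.
Qed.

Context (n : nat).
Implicit Types (x y : 'rV[R]_n) (B : set 'rV[R]_n).

(** Identifies the half-open cube of side 1 / 2^l that contains [x]. *)
Definition dyadic_index l x : 'rV[int]_n :=
  map_mx (fun r => Num.floor (2 ^+ l * r)) x.

Definition dyadic_cube l (z : 'rV[int]_n) : set 'rV[R]_n :=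
  [set x | dyadic_index l x = z].

(** Unions of cubes of level [l], encoded as invariance under equality of indices so that
    complements and unions need no list of cubes. *)
Definition dyadic_set l B :=
  forall x y, dyadic_index l x = dyadic_index l y -> B x -> B y.

Lemma dyadic_indexS l x y :
  dyadic_index l.+1 x = dyadic_index l.+1 y -> dyadic_index l x = dyadic_index l y.
Proof.
move=> /rowP h; apply/rowP => i; have {h} := h i; rewrite !mxE.
(* Twice [Num.floor b] is an integer at most [2 * b], hence at most
   [Num.floor (2 * b) = Num.floor (2 * a)], hence at most [2 * a]. *)
have key (a b : R) : Num.floor (2 * a) = Num.floor (2 * b) ->
    Num.floor b <= Num.floor a.
  move=> ab; rewrite floor_ge_int.
  have : ((Num.floor b * 2)%:~R : R) <= 2 * a.
    rewrite -floor_ge_int ab floor_ge_int intrM mulrC ler_pM2l//.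
    exact: floor_le_tmp.
  by rewrite intrM mulrC ler_pM2l.
by rewrite !exprS -!mulrA => h; apply/le_anti; rewrite !key.
Qed.

Lemma dyadic_set_le l l' B : (l <= l')%N -> dyadic_set l B -> dyadic_set l' B.
Proof.
move=> ll' dB x y xy; apply: dB.
elim: l' ll' xy => [|l' IH]; first by rewrite leqn0 => /eqP ->.
by rewrite leq_eqVlt ltnS => /orP[/eqP ->//|ll' /dyadic_indexS]; exact: IH.
Qed.

Lemma dyadic_setC l B : dyadic_set l B -> dyadic_set l (~` B).
Proof. by move=> dB x y xy Bx By; apply: Bx; apply: dB By. Qed.

Lemma dyadic_setU l l' B B' : dyadic_set l B -> dyadic_set l' B' ->
  dyadic_set (maxn l l') (B `|` B').
Proof.
move=> /(dyadic_set_le (leq_maxl l l')) dB /(dyadic_set_le (leq_maxr l l')) dB'.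
by move=> x y xy [/(dB _ _ xy)|/(dB' _ _ xy)]; [left|right].
Qed.

(** After scaling by 2^l, corresponding coordinates lie in the same unit interval, and the norm is
    the maximum over coordinates. *)
Lemma dyadic_index_dist l x y : dyadic_index l x = dyadic_index l y ->
  `|x - y| <= (2 ^+ l)^-1.
Proof.
move=> /rowP h; rewrite (_ : `|x - y| = mx_norm (x - y))// mx_normrE.
apply: bigmax_le => [|[i j] _ /=].
  by rewrite invr_ge0 exprn_ge0.
rewrite (ord1 i) !mxE; have := h j; rewrite !mxE => hj.
have l0 : 0 < 2 ^+ l :> R by rewrite exprn_gt0.
have /andP[a1 a2] := floor_itv (2 ^+ l * x ord0 j).
have /andP[b1 b2] := floor_itv (2 ^+ l * y ord0 j).
rewrite hj in a1 a2; rewrite -(ler_pM2l l0) mulfV ?gt_eqF//.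
rewrite -[X in X * _](gtr0_norm l0) -normrM mulrBr ler_norml.
rewrite !intrD in a2 b2; lra.
Qed.

Lemma dyadic_cubeE l z : dyadic_cube l z = [set x | forall i,
  [set` `[(z ord0 i)%:~R / 2 ^+ l, (z ord0 i + 1)%:~R / 2 ^+ l[ ] (x ord0 i)].
Proof.
apply/seteqP; split => x /=.
  move=> <- i; rewrite mxE in_itv/= ler_pdivrMr ?ltr_pdivlMr ?exprn_gt0//.
  by rewrite ![x _ _ * _]mulrC floor_itv.
move=> h; apply/rowP => i; rewrite mxE; apply: floor_def; have := h i.
rewrite in_itv/= ler_pdivrMr ?ltr_pdivlMr ?exprn_gt0//.
by rewrite ![x _ _ * _]mulrC.
Qed.

Lemma measurable_dyadic_cube l z : measurable (dyadic_cube l z).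
Proof.
rewrite dyadic_cubeE.
exact: (measurable_rV_box (fun i => measurable_itv _)).
Qed.

Lemma lebesgue_dyadic_cube l z :
  lebesgue_rV n (dyadic_cube l z) = (((2 ^+ l)^-1) ^+ n)%:E.
Proof.
rewrite dyadic_cubeE (lebesgue_rV_box (fun i => measurable_itv _)).
under eq_bigr.
  move=> i _; rewrite lebesgue_measure_itv/= lte_fin ltr_pM2r ?invr_gt0 ?exprn_gt0//.
  rewrite ltr_int ltrDl ltr01 -EFinB -mulrBl intrD addrC addKr mul1r.
  over.
by rewrite prodEFin prodr_const card_ord.
Qed.

Lemma dyadic_set_bigcup l B : dyadic_set l B ->
  B = \bigcup_(z in [set z | dyadic_cube l z `<=` B]) dyadic_cube l z.
Proof.
move=> dB; apply/seteqP; split => [x Bx|x [z /= zB]]; last exact: zB.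
by exists (dyadic_index l x) => // y /= xy; apply: dB Bx; rewrite xy.
Qed.

Lemma measurable_dyadic_set l B : dyadic_set l B -> measurable B.
Proof.
move=> /dyadic_set_bigcup ->; rewrite bigcup_mkcond.
apply: countable_bigcupT_measurable; first exact: countableP.
by move=> z; case: ifPn => // _; exact: measurable_dyadic_cube.
Qed.

(** The sigma-algebra is generated by coordinates, so a countable decomposition is needed. At each
    level, keep the points whose whole cube lies in [B]; as cubes shrink, openness makes these
    dyadic sets exhaust [B]. *)
Lemma open_measurable_rV B : open B -> measurable B.
Proof.
move=> oB.
rewrite (_ : B = \bigcup_l [set x | dyadic_cube l (dyadic_index l x) `<=` B]).
  apply: bigcupT_measurable => l; apply: (@measurable_dyadic_set l).
  by move=> x y /= ->.
apply/seteqP; split => [x Bx|x [l _] /=]; last by apply.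
have /nbhs_ballP[e /= e0 eB] : nbhs x B by move: oB; rewrite openE; apply.
have [l le] := exists_expr2V_lt e0; exists l => // y /= yx.
apply: eB; rewrite mx_norm_ball /ball_/=.
by apply: le_lt_trans le; apply: dyadic_index_dist.
Qed.

End dyadic.

Lemma measurable_continuous_rV (R : realType) n (O : set 'rV[R]_n)
    (f : 'rV[R]_n -> R) : open O -> (forall x, O x -> {for x, continuous f}) ->
  measurable_fun O f.
Proof.
move=> oO cf; apply: (measurability _ (RGenOInfty.measurableE R)).
move=> _ [_ [a ->] <-]; apply: open_measurable_rV.
rewrite openE => x [Ox] /=; rewrite in_itv/= andbT => ax.
apply: filterI; first by move: oO; rewrite openE; apply.
apply: (cf x Ox); apply: (@open_nbhs_nbhs _ (f x) [set` `]a, +oo[ ]).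
by split; [exact: rray_open|rewrite /= in_itv/= ax].
Qed.

(** * Covering Borel null sets by dyadic sets *)

Section dyadic_algebra.
Context (R : realType) (n : nat).
Local Open Scope ereal_scope.

(** A copy of the row vectors whose measurable sets are the dyadic sets of all levels, the algebra
    from which the Caratheodory extension starts. *)
Definition dyadic_rV : Type := 'rV[R]_n.

HB.instance Definition _ := Pointed.on dyadic_rV.

Let dyadic_algebra : set (set dyadic_rV) :=
  [set B | exists l, dyadic_set l (B : set 'rV[R]_n)].

Let dyadic_algebra0 : dyadic_algebra set0.
Proof. by exists 0%N. Qed.

Let dyadic_algebraU : setU_closed dyadic_algebra.
Proof.
by move=> B B' [l dB] [l' dB']; exists (maxn l l'); exact: dyadic_setU.
Qed.

Let dyadic_algebraC : setC_closed dyadic_algebra.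
Proof. by move=> B [l dB]; exists l; exact: dyadic_setC. Qed.

HB.instance Definition _ := isAlgebraOfSets.Build default_measure_display
  dyadic_rV dyadic_algebra0 dyadic_algebraU dyadic_algebraC.

Definition dyadic_lebesgue : set dyadic_rV -> \bar R := @lebesgue_rV R n.

Let dl0 : dyadic_lebesgue set0 = 0. Proof. exact: measure0. Qed.

Let dl_ge0 B : 0 <= dyadic_lebesgue B. Proof. exact: measure_ge0. Qed.

Let dl_sigma_additive : semi_sigma_additive dyadic_lebesgue.
Proof.
move=> F mF tF [l mUF]; apply: measure_semi_sigma_additive => //.
  by move=> i; have [k] := mF i; exact: measurable_dyadic_set.
exact: measurable_dyadic_set mUF.
Qed.

HB.instance Definition _ := isMeasure.Build _ _ _ dyadic_lebesgue
  dl0 dl_ge0 dl_sigma_additive.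

Lemma dyadic_lebesgue_sigma_finite : sigma_finite [set: dyadic_rV] dyadic_lebesgue.
Proof.
pose F i : set 'rV[R]_n := if @unpickle 'rV[int]_n i is Some z then
  dyadic_cube 0 z else set0.
exists F.
  apply/seteqP; split => // x _.
  exists (pickle (dyadic_index 0 (x : 'rV[R]_n))) => //.
  by rewrite /F pickleK.
move=> i; rewrite /F; case: unpickle => [z|]; last by rewrite dl0.
split; first by exists 0%N => x y; rewrite /dyadic_cube/= => ->.
by rewrite /dyadic_lebesgue lebesgue_dyadic_cube ltry.
Qed.

Let borel : measurableType _ := g_sigma_algebraType (@measurable _ dyadic_rV).

Let measurable_coord i : measurable_fun [set: borel]
  (fun x : borel => (x : 'rV[R]_n) ord0 i).
Proof.
apply: (measurability _ (RGenOInfty.measurableE R)) => _ [_ [a ->] <-].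
(* A coordinate exceeds [a] exactly when one of its dyadic truncations does: these approach it from
   below, with error under 1 / 2^l. *)
rewrite setTI (_ : _ @^-1` _ = \bigcup_l [set x : 'rV[R]_n |
    (a < (dyadic_index l x ord0 i)%:~R / 2 ^+ l)%R]); last first.
  apply/seteqP; split => [x /=|x [l _ /=]]; rewrite in_itv/= andbT.
    rewrite -subr_gt0 => /exists_expr2V_lt[l]; rewrite ltrBrDl => al.
    exists l => //=; rewrite mxE ltr_pdivlMr ?exprn_gt0//.
    move: al; rewrite -(@ltr_pM2r _ (2 ^+ l)%R) ?exprn_gt0//.
    rewrite mulrDl mulVf ?gt_eqF ?exprn_gt0// => al.
    have := floorD1_gt (2 ^+ l * x ord0 i)%R; rewrite intrD.
    by move: al; rewrite [(x _ _ * _)%R]mulrC; lra.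
  move=> /lt_le_trans; apply; rewrite mxE ler_pdivrMr ?exprn_gt0//.
  by rewrite mulrC; exact: floor_le_tmp.
apply: bigcupT_measurable => l; apply: sub_sigma_algebra.
by exists l => x y /= ->.
Qed.

(* Caratheodory's extension of Lebesgue measure from the dyadic sets is, by
   uniqueness, Lebesgue measure on all Borel sets. *)
Lemma null_dyadic_cover (N : set 'rV[R]_n) (e : \bar R) : measurable N ->
  lebesgue_rV n N = 0 -> 0 < e ->
  exists F : (set 'rV[R]_n)^nat, [/\ forall i, exists l, dyadic_set l (F i),
    N `<=` \bigcup_i F i & \sum_(i <oo) lebesgue_rV n (F i) < e].
Proof.
move=> mN N0 e0.
(* The identity is measurable in both directions, so the two sigma-algebras agree and Lebesgue
   measure can be carried over to [borel]. *)
have idm : measurable_fun [set: borel] (fun x : borel => x : 'rV[R]_n).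
  exact: measurable_fun_rVP.
have subB (B : set 'rV[R]_n) : measurable B -> measurable (B : set borel).
  by move=> mB; have := idm measurableT _ mB; rewrite setTI.
have mid : measurable_fun [set: 'rV[R]_n] (fun x => x : borel).
  move=> _ B mB; rewrite setTI; move: B mB; apply: smallest_sub.
    exact: sigma_algebra_measurable.
  by move=> B [l]; exact: measurable_dyadic_set.
have [mu' mu'E] := pushforward_sigma_finite
  (sigma_finiteT (@lebesgue_rV R n)) mid idm (fun x => erefl _).
have ext0 : measure_extension dyadic_lebesgue N = 0.
  rewrite (@measure_extension_unique _ _ _ dyadic_lebesgue
    dyadic_lebesgue_sigma_finite mu').
  - exact: etrans (congr1 (@^~ N) mu'E) N0.
  - by move=> X _; exact: esym (congr1 (@^~ X) mu'E).
  - exact: subB.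
have : measure_extension dyadic_lebesgue N < e by rewrite ext0.
(* The extension is an infimum of total masses over countable dyadic covers, so a value below [e]
   provides a cover. *)
by move=> /ereal_inf_lt[_ [F [dF NF] <-] Fe]; exists F.
Qed.

End dyadic_algebra.

(** * Null sets under differentiable maps *)

Section null_image.
Context (R : realType).

(* Every point of differentiability lies in one of these countably many sets. *)
Definition lipschitz_at n n' (f : 'rV[R]_n -> 'rV[R]_n') (K : nat) : set 'rV[R]_n :=
  [set x | forall y,
    `|y - x| < K.+1%:R^-1 -> `|f y - f x| <= K.+1%:R * `|y - x|].

(** Near [x] the remainder is at most [|y - x|] and the differential is bounded with constant
    [|C| + 1], so the increment has slope at most [|C| + 2]. *)
Lemma differentiable_lipschitz_at n n' (f : 'rV[R]_n -> 'rV[R]_n') x :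
  differentiable f x -> exists K, lipschitz_at f K x.
Proof.
move=> df; have [dfc /eqaddoP/(_ _ ltr01) fo] := (diff_locallyP _ _).1 df.
have /linear_boundedP[C [_ /(_ (`|C| + 1))]] := continuous_linear_bounded 0 (dfc 0).
move=> /(_ (le_lt_trans (ler_norm _) _)) dC.
move: fo => /nbhs_ballP[e /= e0 fo].
have [k _ /(_ k (leqnn k)) ke] := near_infty_natSinv_lt (PosNum e0).
(* The first term puts the radius [K.+1%:R^-1] below [e]; the second makes [K.+1] dominate the
   slope. *)
exists (maxn k (Num.bound (`|C| + 2))) => y yx.
have yxe : ball (0 : 'rV[R]_n) e (y - x).
  rewrite mx_norm_ball /ball_/= sub0r normrN; apply: lt_trans ke.
  apply: lt_le_trans yx _; rewrite lef_pV2 ?posrE// ler_nat ltnS.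
  exact: leq_maxl.
have := fo _ yxe; rewrite mul1r !fctE/= subrK => hf.
have {hf} : `|f y - f x| <= `|y - x| + (`|C| + 1) * `|y - x|.
  rewrite -(subrK ('d f x (y - x)) (f y - f x)).
  apply: le_trans (ler_normD _ _) _; apply: lerD; last by apply: dC; rewrite ltrDl.
  by rewrite -addrA -opprD.
move=> /le_trans; apply; rewrite -{1}[`|y - x|]mul1r -mulrDl ler_wpM2r//.
apply: (@le_trans _ _ (Num.bound (`|C| + 2))%:R); last first.
  by rewrite ler_nat ltnW// ltnS leq_maxr.
by apply: ltW; rewrite [1 + _]addrC -addrA; apply: archi_boundP; rewrite addr_ge0.
Qed.

Local Open Scope ereal_scope.

(** Intersecting covers of mass at most 1 / (k + 1) over all [k] gives a measurable null cover. *)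
Lemma negligible_small_cover d (T : measurableType d)
    (mu : {measure set T -> \bar R}) (X : set T) :
  (forall e : R, (0 < e)%R ->
    exists C, [/\ measurable C, X `<=` C & mu C <= e%:E]) ->
  mu.-negligible X.
Proof.
move=> h.
have /choice[C hC] k : exists C, [/\ measurable C, X `<=` C & mu C <= (k.+1%:R^-1)%:E].
  by apply: h; rewrite invr_gt0.
exists (\bigcap_k C k); split.
- by apply: bigcapT_measurable => k; have [] := hC k.
- apply/eqP; rewrite eq_le measure_ge0 andbT; apply/lee_addgt0Pr => e e0.
  have [k _ /(_ k (leqnn k)) ke] := near_infty_natSinv_lt (PosNum e0).
  have [mk _ muk] := hC k; rewrite add0e; apply: (@le_trans _ _ (mu (C k))).
    apply: le_measure; rewrite ?inE//; last exact: bigcap_inf.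
    by apply: bigcapT_measurable => j; have [] := hC j.
  by apply: le_trans muk _; rewrite lee_fin ltW.
- by move=> x Xx k _; have [_ + _] := hC k; apply.
Qed.

(** The closed ball of the maximum norm, written as a box so that its volume is a product of
    lengths. *)
Definition closed_box n (c : 'rV[R]_n) (r : R) : set 'rV[R]_n :=
  [set y | forall i, [set` `[c ord0 i - r, c ord0 i + r]%R ] (y ord0 i)].

Lemma measurable_closed_box n c r : measurable (@closed_box n c r).
Proof. exact: (measurable_rV_box (fun i => measurable_itv _)). Qed.

Lemma lebesgue_closed_box n c r : (0 < r)%R ->
  lebesgue_rV n (closed_box c r) = ((2 * r) ^+ n)%:E.
Proof.
move=> r0; rewrite /closed_box (lebesgue_rV_box (fun i => measurable_itv _)).
rewrite (eq_bigr (fun=> (2 * r)%:E)) => [|i _].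
  by rewrite prodEFin prodr_const card_ord.
rewrite lebesgue_measure_itv/= lte_fin ltrD2l gtrN// -EFinB.
by congr (_%:E); lra.
Qed.

Lemma closed_boxP n (c y : 'rV[R]_n) r : (`|y - c| <= r)%R -> closed_box c r y.
Proof.
move=> yc i /=; rewrite in_itv/= -ler_distl; apply: le_trans yc.
rewrite (_ : `|y - c|%R = mx_norm (y - c))// mx_normrE.
have := @le_bigmax _ _ _ 0%R (fun ij : 'I_1 * 'I_n => `|(y - c) ij.1 ij.2|%R) (ord0, i).
by rewrite !mxE.
Qed.

(** A cube of side s = 1 / 2^l containing a point of [lipschitz_at f K] is sent, on that set, into a
    box of radius (K + 1) s, whose volume is (2 (K + 1))^n times that of the cube. Summing over the
    disjoint cubes of [G] gives the bound. *)
Lemma dyadic_image_cover n (f : 'rV[R]_n -> 'rV[R]_n) K l (G : set 'rV[R]_n) :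
  dyadic_set l G -> ((2 ^+ l)^-1 < K.+1%:R^-1 :> R)%R ->
  exists C, [/\ measurable C, f @` (G `&` lipschitz_at f K) `<=` C &
    lebesgue_rV n C <= ((2 * K.+1%:R) ^+ n)%:E * lebesgue_rV n G].
Proof.
move=> dG lK.
have l0 : (0 < (2 ^+ l)^-1 :> R)%R by rewrite invr_gt0 exprn_gt0.
pose c : R := ((2 * K.+1%:R) ^+ n)%R.
have /choice[D hD] (z : 'rV[int]_n) : exists D, [/\ measurable D,
    f @` (dyadic_cube l z `&` G `&` lipschitz_at f K) `<=` D &
    lebesgue_rV n D <= c%:E * lebesgue_rV n (dyadic_cube l z `&` G)].
  (* The box is centred at the image of one good point of the cube; the whole cube then lies in [G].
     Without such a point the empty set suffices. *)
  have [[x [[xz Gx] Kx]]|no] :=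
      pselect (exists x, (dyadic_cube l z `&` G `&` lipschitz_at f K) x); last first.
    exists set0; split => //; last by rewrite measure0 mule_ge0// lee_fin exprn_ge0.
    by move=> y [x xG _]; case: no; exists x.
  exists (closed_box (f x) (K.+1%:R * (2 ^+ l)^-1)); split.
  - exact: measurable_closed_box.
  - move=> _ [y [[yz _] _] <-]; apply: closed_boxP.
    have yx : (`|y - x| <= (2 ^+ l)^-1)%R.
      by apply: dyadic_index_dist; rewrite (yz : _ = z) xz.
    by apply: le_trans (Kx _ (le_lt_trans yx lK)) _; rewrite ler_wpM2l.
  - rewrite lebesgue_closed_box ?mulr_gt0// (_ : _ `&` G = dyadic_cube l z).
      by rewrite lebesgue_dyadic_cube -EFinM lee_fin mulrA exprMn.
    apply/seteqP; split => [y []//|y yz]; split => //.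
    by apply: dG Gx; rewrite (yz : _ = z) xz.
(* [pickle_inv] decodes only true codes, so distinct indices give distinct cubes and the sets [E i]
   are disjoint. *)
pose oz i := @pickle_inv 'rV[int]_n i.
pose E i := if oz i is Some z then dyadic_cube l z `&` G else set0.
have mE i : measurable (E i).
  rewrite /E; case: (oz i) => // z; apply: measurableI.
    exact: measurable_dyadic_cube.
  exact: measurable_dyadic_set dG.
have GE : G = \bigcup_i E i.
  apply/seteqP; split => [x Gx|x [i _]]; last by rewrite /E; case: (oz i) => // z [].
  by exists (pickle (dyadic_index l x)) => //; rewrite /E /oz pickleK_inv.
have tE : trivIset setT E.
  apply/trivIsetP => i j _ _ ij; apply/seteqP; split => // x [].
  rewrite /E /oz; have := @pickle_invK 'rV[int]_n i; have := @pickle_invK 'rV[int]_n j.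
  case: (pickle_inv i) => [z|//]; case: (pickle_inv j) => [z'|//] /= jz' iz.
  by move=> [[xz _] [xz' _]]; move/eqP: ij; apply; rewrite -iz -jz' -xz -xz'.
exists (\bigcup_i if oz i is Some z then D z else set0); split.
- by apply: bigcupT_measurable => i; case: (oz i) => // z; have [] := hD z.
- move=> _ [x [Gx Kx] <-]; exists (pickle (dyadic_index l x)) => //.
  rewrite /oz pickleK_inv; have [_ + _] := hD (dyadic_index l x); apply.
  by exists x.
- apply: (@le_trans _ _ (\sum_(i <oo) c%:E * lebesgue_rV n (E i))).
    apply: (@le_trans _ _ (\sum_(i <oo) lebesgue_rV n
        (if oz i is Some z then D z else set0))).
      apply: measure_sigma_subadditive => //.
        by move=> i; case: (oz i) => // z; have [] := hD z.
      by apply: bigcupT_measurable => i; case: (oz i) => // z; have [] := hD z.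
    apply: lee_nneseries => i _; rewrite ?measure_ge0// /E.
    case: (oz i) => [z|]; first by have [] := hD z.
    by rewrite !measure0 mule0.
  rewrite nneseriesZl; last by [].
  rewrite GE; have mUE := bigcupT_measurable _ mE.
  have /cvg_lim <-// := measure_semi_sigma_additive
    (s := lebesgue_rV n : {measure set _ -> \bar R}) E mE tE mUE.
Qed.

(** A dyadic cover of [N] of mass below [e / c] has an image covered with mass at most [e], since
    each piece grows by a factor of at most [c]. *)
Lemma null_image_lipschitz n (f : 'rV[R]_n -> 'rV[R]_n) K (N : set 'rV[R]_n) :
  measurable N -> lebesgue_rV n N = 0 ->
  (lebesgue_rV n).-negligible (f @` (N `&` lipschitz_at f K)).
Proof.
move=> mN N0; apply: negligible_small_cover => e e0.
pose c : R := ((2 * K.+1%:R) ^+ n)%R.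
have c0 : (0 < c)%R by rewrite exprn_gt0// mulr_gt0.
have ec0 : 0 < (e / c)%:E by rewrite lte_fin divr_gt0.
have [F [dF NF Fe]] := null_dyadic_cover mN N0 ec0.
have [L hL] := @exists_expr2V_lt R K.+1%:R^-1 ltac:(by rewrite invr_gt0).
have /choice[C hC] i : exists C, [/\ measurable C,
    f @` (F i `&` lipschitz_at f K) `<=` C &
    lebesgue_rV n C <= c%:E * lebesgue_rV n (F i)].
  have [l dFl] := dF i.
  (* A dyadic set remains dyadic at finer levels; level [L] makes its cubes smaller than the radius
     [K.+1%:R^-1]. *)
  apply: (@dyadic_image_cover n f K (maxn l L)).
    exact: dyadic_set_le (leq_maxl _ _) dFl.
  apply: le_lt_trans hL; rewrite lef_pV2 ?posrE ?exprn_gt0//.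
  by rewrite ler_weXn2l ?ler1n// leq_maxr.
have mC i : measurable (C i) by have [] := hC i.
exists (\bigcup_i C i); split; first exact: bigcupT_measurable.
  move=> _ [x [/NF[i _ Fx] Kx] <-]; exists i => //; have [_ + _] := hC i; apply.
  by exists x.
apply: (@le_trans _ _ (\sum_(i <oo) lebesgue_rV n (C i))).
  by apply: measure_sigma_subadditive => //; exact: bigcupT_measurable.
apply: (@le_trans _ _ (\sum_(i <oo) c%:E * lebesgue_rV n (F i))).
  by apply: lee_nneseries => i _; rewrite ?measure_ge0//; have [] := hC i.
rewrite nneseriesZl; last by [].
by rewrite -lee_pdivlMl// -EFinM mulrC ltW.
Qed.

(** The countably many sets [lipschitz_at f K] exhaust [N]. The dimensions are related by an
    equation because those of the two ends of a jump are equal only propositionally. *)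
Lemma null_image_differentiable n n' (f : 'rV[R]_n -> 'rV[R]_n') (N : set 'rV[R]_n) :
  n = n' -> measurable N -> lebesgue_rV n N = 0 ->
  (forall x, N x -> differentiable f x) ->
  (lebesgue_rV n').-negligible (f @` N).
Proof.
move=> nn'; case: _ / nn' f => f mN N0 df.
have -> : f @` N = \bigcup_K f @` (N `&` lipschitz_at f K).
  apply/seteqP; split => [_ [x Nx <-]|_ [K _ [x [Nx _] <-]]]; last by exists x.
  have [K Kx] := differentiable_lipschitz_at (df _ Nx).
  by exists K => //; exists x.
by apply: negligible_bigcup => K; exact: null_image_lipschitz.
Qed.

End null_image.

(** * Jacobians of mutually inverse maps *)

Section jacobian_inverse.
Context (R : realType).

(** Destructing one dimension equation makes both matrices square; the other is then reflexivity, by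
    uniqueness of identity proofs on naturals, and the determinant is multiplicative. *)
Lemma det_castmx_mul1 a b (ba : b = a) (ab : a = b) (A : 'M[R]_(a, b))
    (B : 'M[R]_(b, a)) : A *m B = 1%:M ->
  \det (castmx (erefl, ba) A) * \det (castmx (erefl, ab) B) = 1.
Proof.
case: _ / ba A B ab => A B ab AB.
by rewrite (eq_axiomK ab) !castmx_id -det_mulmx AB det1.
Qed.

(** The chain rule applied to [g \o f], which is the identity near [x]. The factors come in this
    order because vectors are rows. *)
Lemma jacobian_inverse n n' (O : set 'rV[R]_n) (f : 'rV[R]_n -> 'rV[R]_n')
    (g : 'rV[R]_n' -> 'rV[R]_n) x :
  open O -> O x -> (forall y, O y -> g (f y) = y) ->
  differentiable f x -> differentiable g (f x) ->
  jacobian f x *m jacobian g (f x) = 1%:M.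
Proof.
move=> oO Ox gK df dg.
have dgf : differentiable (g \o f) x by exact: differentiable_comp.
have gf_id : {near x, g \o f =1 id}.
  near=> y; apply: gK; near: y.
  by move: oO; rewrite openE; apply.
apply/row_matrixP => i; rewrite !rowE mulmx1 mulmxA /jacobian !mul_rV_lin1/=.
rewrite -[LHS]/(('d g (f x) \o 'd f x) _) -diff_comp// -deriveE//.
by rewrite (near_eq_derive _ gf_id) deriveE// diff_val.
Unshelve. all: by end_near. Qed.

End jacobian_inverse.

(** * The sampler, extended by zero outside the supports *)

(** Inversion is continuous away from 0, and the point 0 is treated as a separate measurable
    piece. *)
Lemma measurable_invr (R : realType) : measurable_fun [set: R] (@GRing.inv R).
Proof.
have -> : [set: R] = [set x | x != 0] `|` [set 0].
  by apply/seteqP; split => // x _; have [->|] := eqVneq x 0; [right|left].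
have o0 : open [set x : R | x != 0] by exact: open_neq.
apply/measurable_funU => //; first exact: open_measurable.
split; last exact: measurable_fun_set1.
by apply: open_continuous_measurable_fun => // x; rewrite inE/= => /inv_continuous.
Qed.

Lemma measurable_if_in d d' (T1 : measurableType d) (T2 : measurableType d')
    (D : set T1) (f : T1 -> T2) c : measurable D -> measurable_fun D f ->
  measurable_fun setT (fun x => if x \in D then f x else c).
Proof.
move=> mD mf; have DE : (fun x => x \in D) @^-1` [set true] = D.
  by apply/seteqP; split => x; [exact: set_mem|exact: mem_set].
apply: measurable_fun_if => //.
- by apply: (measurable_fun_bool true); rewrite setTI DE.
- by rewrite setTI DE.
Qed.

Lemma measurable_if_in_rV d (T : measurableType d) (R : realType) n (D : set T)
    (f : T -> 'rV[R]_n) : measurable D ->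
  (forall i, measurable_fun D (fun x => f x ord0 i)) ->
  measurable_fun setT (fun x => if x \in D then f x else 0).
Proof.
move=> mD mf; apply: measurable_fun_rVP => i.
have := measurable_if_in (0 : R) mD (mf i); apply: eq_measurable_fun => x _.
by case: ifPn => //; rewrite mxE.
Qed.

Lemma measurable_det_castmx d (T : measurableType d) (R : realType) a b
    (ba : b = a) (D : set T) (F : T -> 'M[R]_(a, b)) :
  (forall i j, measurable_fun D (fun x => F x i j)) ->
  measurable_fun D (fun x => \det (castmx (erefl a, ba) (F x))).
Proof.
case: _ / ba F => F mF; rewrite /determinant; apply: measurable_sum => s.
apply: measurable_funM => //.
apply: measurable_prod => i _.
by under eq_fun do rewrite castmx_id; exact: mF.
Qed.

Section patched.
Context (R : realType) (Y : Type) (M : nat) (A : sampler R Y M) (y : Y).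
Hypothesis hS : sampler_spec A y.
Implicit Types m : 'I_M.

Notation pair m m' := 'rV[R]_(pdim A m + adim A m m').

(* The weights and proposals are only constrained on the supports; the trials
   outside them have density zero, so setting them to zero there makes all
   integrands measurable and nonnegative without changing any probability. *)
Definition jump0 m m' (x : pair m m') : pair m' m :=
  if x \in supp A m m' then jump A m m' x else 0.
Definition aux0 m m' (x : pair m m') : R :=
  if x \in supp A m m' then aux_density A m' (lsubmx x) (rsubmx x) else 0.
Definition weight0 m m' (x : pair m m') : R :=
  if x \in supp A m m' then
    weight A (lsubmx x) (lsubmx (jump A m m' x) : 'rV[R]_(pdim A m')) else 0.
Definition jac0 m m' (x : pair m m') : R :=
  if x \in supp A m m' then abs_jacobian A x else 0.
Definition target0 m (theta : 'rV[R]_(pdim A m)) : R :=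
  if theta \in Theta A m then target A y theta else 0.

Lemma jumpK m m' (x : pair m m') : supp A m m' x ->
  jump A m' m (jump A m m' x) = x.
Proof.
move=> Sx; have [U hU] := jump_C1 hS; have [SO _ OK] := hU m m'.
by have [] := OK _ (SO _ Sx).
Qed.

Lemma differentiable_jump m m' (x : pair m m') : supp A m m' x ->
  differentiable (jump A m m') x.
Proof.
move=> Sx; have [U hU] := jump_C1 hS; have [SO [_ dO] _] := hU m m'.
by have [] := dO _ (SO _ Sx).
Qed.

Lemma abs_jacobian_mul1 m m' (x : pair m m') : supp A m m' x ->
  abs_jacobian A x * abs_jacobian A (jump A m m' x) = 1.
Proof.
move=> Sx; have [U hU] := jump_C1 hS; have [SO [oO dO] OK] := hU m m'.
rewrite /abs_jacobian -normrM det_castmx_mul1 ?normr1//.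
apply: (jacobian_inverse oO (SO _ Sx)).
- by move=> z /OK[].
- exact: differentiable_jump.
- by apply: differentiable_jump; exact: (jump_supp hS).
Qed.

(** The jump is continuous on an open neighbourhood of the support, hence measurable there and on
    the support itself. *)
Lemma measurable_jump0 m m' : measurable_fun setT (@jump0 m m').
Proof.
have [U hU] := jump_C1 hS; have [SO [oO dO] _] := hU m m'.
apply: measurable_if_in_rV; first exact: (supp_measurable hS).
move=> i; apply: measurable_funS (open_measurable_rV oO) SO _.
apply: measurable_continuous_rV => // x /dO[df _].
apply: (@continuous_comp _ _ _ (jump A m m') (fun z : pair m' m => z ord0 i)).
  exact: differentiable_continuous.
exact: coord_continuous.
Qed.

Lemma measurable_jac0 m m' : measurable_fun setT (@jac0 m m').
Proof.
have [U hU] := jump_C1 hS; have [SO [oO dO] _] := hU m m'.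
apply: measurable_if_in; first exact: (supp_measurable hS).
apply: measurable_funS (open_measurable_rV oO) SO _.
apply: (measurableT_comp (@normr_measurable R setT)).
apply: measurable_det_castmx => i j.
apply: measurable_continuous_rV => // x /dO[_ cj].
apply: (@continuous_comp _ _ _ (jacobian (jump A m m'))
  (fun z : 'M[R]_(_, _) => z i j)); first exact: cj.
exact: coord_continuous.
Qed.

Lemma measurable_aux0 m m' : measurable_fun setT (@aux0 m m').
Proof.
have mS : measurable (supp A m m') by exact: (supp_measurable hS).
apply: measurable_if_in => //.
apply: (measurable_comp (F := Theta A m `*` setT)
  (f := fun z : _ * 'rV[R]_(adim A m m') => aux_density A m' z.1 z.2)
  (g := fun x : pair m m' => (lsubmx x, rsubmx x))).
- by apply: measurableX => //; exact: (Theta_measurable hS).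
- by move=> _ [x Sx <-]; split => //=; exact: (supp_Theta hS).
- exact: (aux_density_measurable hS).
- apply: measurable_funTS; apply: measurable_fun_pair.
    exact: measurable_lsubmx.
  exact: measurable_rsubmx.
Qed.

Lemma measurable_weight0 m m' : measurable_fun setT (@weight0 m m').
Proof.
have mS : measurable (supp A m m') by exact: (supp_measurable hS).
apply: measurable_if_in => //.
(* On the support [jump] may be replaced by [jump0], which is measurable everywhere. *)
apply: (@eq_measurable_fun _ _ _ _ _
  (fun x => weight A (lsubmx x) (lsubmx (jump0 x) : 'rV[R]_(pdim A m')))).
  by move=> x; rewrite /jump0 => ->.
apply: (measurable_comp (F := Theta A m `*` Theta A m')
  (f := fun z : 'rV[R]_(pdim A m) * 'rV[R]_(pdim A m') => weight A z.1 z.2)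
  (g := fun x : pair m m' => (lsubmx x, lsubmx (jump0 x)))).
- by apply: measurableX => //; exact: (Theta_measurable hS).
- move=> _ [x Sx <-]; split => /=; first exact: (supp_Theta hS).
  by rewrite /jump0 mem_set//; apply: (supp_Theta hS); exact: (jump_supp hS).
- exact: (weight_measurable hS).
- apply: measurable_funTS; apply: measurable_fun_pair.
    exact: measurable_lsubmx.
  by apply: measurableT_comp; [exact: measurable_lsubmx|exact: measurable_jump0].
Qed.

Lemma measurable_target0 m : measurable_fun setT (@target0 m).
Proof.
apply: measurable_if_in; first exact: (Theta_measurable hS).
apply: measurable_funM; last exact: measurable_cst.
apply: measurable_funM; first exact: (likelihood_measurable hS).
exact: (prior_measurable hS).
Qed.

Lemma aux0_ge0 m m' (x : pair m m') : 0 <= aux0 x.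
Proof.
rewrite /aux0; case: ifPn => //; rewrite inE => Sx.
by apply: (aux_density_ge0 hS); exact: (supp_Theta hS).
Qed.

Lemma aux0_row_mx m m' (theta : 'rV[R]_(pdim A m)) (u : 'rV[R]_(adim A m m')) :
  Theta A m theta -> aux0 (row_mx theta u) = aux_density A m' theta u.
Proof.
move=> Ttheta; rewrite /aux0 row_mxKl row_mxKr; case: ifPn => //.
by move=> /negP; rewrite inE => /(aux_density_supp hS) ->.
Qed.

Lemma weight0_gt0 m m' (x : pair m m') : supp A m m' x -> 0 < weight0 x.
Proof.
move=> Sx; rewrite /weight0 mem_set//; apply: (weight_gt0 hS).
  exact: (supp_Theta hS).
by apply: (supp_Theta hS); exact: (jump_supp hS).
Qed.

Lemma weight0_ge0 m m' (x : pair m m') : 0 <= weight0 x.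
Proof.
have [Sx|Sx] := boolP (x \in supp A m m').
  by apply/ltW/weight0_gt0; exact: set_mem.
by rewrite /weight0 (negPf Sx).
Qed.

Lemma jac0_ge0 m m' (x : pair m m') : 0 <= jac0 x.
Proof. by rewrite /jac0; case: ifPn => // _; exact: normr_ge0. Qed.

Lemma target0_ge0 m (theta : 'rV[R]_(pdim A m)) : 0 <= target0 theta.
Proof.
rewrite /target0; case: ifPn => //; rewrite inE => Ttheta.
rewrite mulr_ge0 ?(model_prior_ge0 hS)// mulr_ge0//.
  exact: (likelihood_ge0 hS).
exact: (prior_ge0 hS).
Qed.

End patched.

Arguments measurable_jump0 {R Y M A y} hS m m'.
Arguments measurable_jac0 {R Y M A y} hS m m'.
Arguments measurable_aux0 {R Y M A y} hS m m'.
Arguments measurable_weight0 {R Y M A y} hS m m'.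
Arguments measurable_target0 {R Y M A y} hS m.

(** * Densities of the trials, selection and acceptance *)

Section trial_density.
Context (R : realType) (Y : Type) (M : nat) (A : sampler R Y M) (y : Y).
Hypothesis hS : sampler_spec A y.
Implicit Types (m : 'I_M) (n : nat).

Notation par m := 'rV[R]_(pdim A m).
Notation aux m m' := 'rV[R]_(adim A m m').
Notation pair m m' := 'rV[R]_(pdim A m + adim A m m').

Definition trials_lik n m m' (theta : par m) (us : n.-tuple (aux m m')) : R :=
  \prod_(i < n) aux0 (row_mx theta (tnth us i)).

(** The competitors are listed without the selected pair, so the same formula serves the forward
    selection and the reverse one. *)
Definition select0 n m m' (x : pair m m') (us : n.-tuple (aux m m')) : R :=
  weight0 x /
  (weight0 x + \sum_(i < n) weight0 (row_mx (lsubmx x) (tnth us i))).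

(** The acceptance ratio compares this quantity at the two ends of the move. *)
Definition flow n m m' (x : pair m m') (us : n.-tuple (aux m m')) : R :=
  target0 y (lsubmx x) * propose A m m' * aux0 x * select0 x us.

Definition accept0 n m m' (x : pair m m') (us : n.-tuple (aux m m'))
    (vs : n.-tuple (aux m' m)) : R :=
  if flow x us == 0 then 1
  else Num.min 1 (flow (jump0 x) vs / flow x us * jac0 x).

(** Density of the selected trial, its competitors and the reverse trials, times the probabilities
    of selection and acceptance; the proposal probability is left out. *)
Definition joint n m m' (x : pair m m') (us : n.-tuple (aux m m'))
    (vs : n.-tuple (aux m' m)) : R :=
  aux0 x * trials_lik (lsubmx x) us * select0 x us *
  (trials_lik (lsubmx (jump0 x)) vs * accept0 x us vs).

Section measurability.
Context d (T : measurableType d) (n : nat) (m m' : 'I_M).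
Variables (f : T -> pair m m') (g : T -> n.-tuple (aux m m'))
  (h : T -> n.-tuple (aux m' m)).
Hypotheses (mf : measurable_fun setT f) (mg : measurable_fun setT g)
  (mh : measurable_fun setT h).

Lemma measurable_trials_lik (theta : T -> par m) : measurable_fun setT theta ->
  measurable_fun setT (fun t => trials_lik (theta t) (g t)).
Proof.
move=> mtheta; apply: measurable_prod => i _.
apply: measurableT_comp; first exact: (measurable_aux0 hS _ _).
apply: measurable_row_mx => //.
exact: (measurableT_comp (measurable_tnth _) mg).
Qed.

Lemma measurable_select0 : measurable_fun setT (fun t => select0 (f t) (g t)).
Proof.
have mw : measurable_fun setT (fun t => weight0 (f t)).
  exact: (measurableT_comp (measurable_weight0 hS _ _) mf).
apply: measurable_funM => //.
apply: (measurableT_comp (@measurable_invr R)); apply: measurable_funD => //.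
apply: measurable_sum => i.
apply: measurableT_comp; first exact: (measurable_weight0 hS _ _).
apply: measurable_row_mx.
  exact: (measurableT_comp (@measurable_lsubmx _ _ _) mf).
exact: (measurableT_comp (measurable_tnth _) mg).
Qed.

Lemma measurable_flow : measurable_fun setT (fun t => flow (f t) (g t)).
Proof.
apply: measurable_funM; last exact: measurable_select0.
apply: measurable_funM; last first.
  exact: (measurableT_comp (measurable_aux0 hS _ _) mf).
apply: measurable_funM => //.
apply: measurableT_comp; first exact: (measurable_target0 hS _).
exact: (measurableT_comp (@measurable_lsubmx _ _ _) mf).
Qed.

End measurability.

Lemma measurable_reverse d (T : measurableType d) n m m'
    (f : T -> pair m m') (g : T -> n.-tuple (aux m m'))
    (h : T -> n.-tuple (aux m' m)) :
  measurable_fun setT f -> measurable_fun setT g -> measurable_fun setT h ->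
  measurable_fun setT (fun t => trials_lik (lsubmx (jump0 (f t))) (h t) *
    accept0 (f t) (g t) (h t)).
Proof.
move=> mf mg mh.
have mjf : measurable_fun setT (fun t => jump0 (f t)).
  exact: (measurableT_comp (measurable_jump0 hS _ _) mf).
have mflow := measurable_flow mf mg.
apply: measurable_funM.
  apply: measurable_trials_lik => //.
  exact: (measurableT_comp (@measurable_lsubmx _ _ _) mjf).
apply: measurable_fun_ifT => //; first exact: measurable_fun_eqr.
apply: measurable_minr => //; apply: measurable_funM.
  apply: measurable_funM; first exact: measurable_flow.
  exact: (measurableT_comp (@measurable_invr R)).
exact: (measurableT_comp (measurable_jac0 hS _ _) mf).
Qed.

Lemma measurable_joint d (T : measurableType d) n m m'
    (f : T -> pair m m') (g : T -> n.-tuple (aux m m'))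
    (h : T -> n.-tuple (aux m' m)) :
  measurable_fun setT f -> measurable_fun setT g -> measurable_fun setT h ->
  measurable_fun setT (fun t => joint (f t) (g t) (h t)).
Proof.
move=> mf mg mh; apply: measurable_funM; last exact: measurable_reverse.
apply: measurable_funM; last exact: measurable_select0.
apply: measurable_funM.
  exact: (measurableT_comp (measurable_aux0 hS _ _) mf).
apply: measurable_trials_lik => //.
exact: (measurableT_comp (@measurable_lsubmx _ _ _) mf).
Qed.

Lemma trials_lik_ge0 n m m' (theta : par m) (us : n.-tuple (aux m m')) :
  0 <= trials_lik theta us.
Proof. by apply: prodr_ge0 => i _; exact: (aux0_ge0 hS). Qed.

Lemma select0_ge0 n m m' (x : pair m m') (us : n.-tuple (aux m m')) :
  0 <= select0 x us.
Proof.
rewrite divr_ge0 ?addr_ge0 ?sumr_ge0 ?(weight0_ge0 hS)// => i _.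
exact: (weight0_ge0 hS).
Qed.

Lemma flow_ge0 n m m' (x : pair m m') (us : n.-tuple (aux m m')) : 0 <= flow x us.
Proof.
apply: mulr_ge0; last exact: select0_ge0.
apply: mulr_ge0; last exact: (aux0_ge0 hS).
by apply: mulr_ge0; [exact: (target0_ge0 hS)|exact: (propose_ge0 hS)].
Qed.

Lemma accept0_ge0 n m m' (x : pair m m') (us : n.-tuple (aux m m'))
  (vs : n.-tuple (aux m' m)) : 0 <= accept0 x us vs.
Proof.
rewrite /accept0; case: ifPn => // _.
by rewrite le_min ler01/= mulr_ge0 ?divr_ge0 ?flow_ge0// jac0_ge0.
Qed.

Lemma joint_ge0 n m m' (x : pair m m') (us : n.-tuple (aux m m'))
  (vs : n.-tuple (aux m' m)) : 0 <= joint x us vs.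
Proof.
apply: mulr_ge0; apply: mulr_ge0.
- by apply: mulr_ge0; [exact: (aux0_ge0 hS)|exact: trials_lik_ge0].
- exact: select0_ge0.
- exact: trials_lik_ge0.
- exact: accept0_ge0.
Qed.

Lemma flow_accept0 n m m' (x : pair m m') (us : n.-tuple (aux m m'))
    (vs : n.-tuple (aux m' m)) :
  flow x us * accept0 x us vs = Num.min (flow x us) (flow (jump0 x) vs * jac0 x).
Proof.
have fj0 : 0 <= flow (jump0 x) vs * jac0 x by rewrite mulr_ge0 ?flow_ge0 ?jac0_ge0.
(* At zero flow the acceptance is 1 by convention, and both sides are 0 because the other argument
   of the minimum is nonnegative. *)
rewrite /accept0; case: ifPn => [/eqP ->|f0]; first by rewrite mul0r min_l.
rewrite minr_pMr ?flow_ge0// mulr1; congr Num.min.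
by rewrite mulrA mulrCA mulfV// mulr1.
Qed.

Lemma weight0_row_mx m m' (theta : par m) (u : aux m m') :
  supp A m m' (row_mx theta u) ->
  weight0 (row_mx theta u) = weight A theta (new_par theta u : par m').
Proof. by move=> Su; rewrite /weight0 mem_set// row_mxKl. Qed.

(** Splitting the sum of weights at [j] shows that the position of the selected trial is
    immaterial. *)
Lemma select_probE n m m' (theta : par m) (j : 'I_n.+1) u
    (us : n.-tuple (aux m m')) : supp A m m' (row_mx theta u) ->
  (forall i, supp A m m' (row_mx theta (tnth us i))) ->
  select_prob (m' := m') theta (tinsert j u us) j = select0 (row_mx theta u) us.
Proof.
move=> Su Sus; rewrite /select_prob /select0 tnth_tinsert row_mxKl.
rewrite (bigD1_ord j)//= tnth_tinsert weight0_row_mx//.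
congr (_ / (_ + _)); apply: eq_bigr => i _.
by rewrite tnth_tinsert_lift weight0_row_mx.
Qed.

Lemma accept_probE n m m' (theta : par m) (j : 'I_n.+1) u
    (us : n.-tuple (aux m m')) (vs : n.-tuple (aux m' m)) :
  supp A m m' (row_mx theta u) ->
  (forall i, supp A m m' (row_mx theta (tnth us i))) ->
  (forall i, supp A m' m (row_mx (new_par theta u) (tnth vs i))) ->
  accept_prob y (k := n.+1) theta (tinsert j u us) j vs =
  accept0 (row_mx theta u) us vs.
Proof.
move=> Su Sus Svs; rewrite /accept_prob select_probE// tnth_tinsert.
have gE : jump0 (row_mx theta u) = row_mx (new_par theta u) (new_aux theta u).
  by rewrite /jump0 mem_set// hsubmxK.
have Sg : supp A m' m (row_mx (new_par theta u) (new_aux theta u)).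
  by rewrite hsubmxK; exact: (jump_supp hS).
have Ttheta : Theta A m theta by have := supp_Theta hS Su; rewrite row_mxKl.
have Ttheta' : Theta A m' (new_par theta u) by exact: (supp_Theta hS (jump_supp hS Su)).
have nE : new_par (new_par theta u) (new_aux theta u) = theta.
  by rewrite /new_par /new_aux hsubmxK (jumpK hS)// row_mxKl.
rewrite /accept0 gE /flow !row_mxKl /target0 !mem_set// !(aux0_row_mx hS)//.
(* The reverse jump from the new pair returns to [theta], so the weight of [theta] in the reverse
   sum is [weight0] of that pair. *)
have -> : reverse_select_prob (k := n.+1) (new_par theta u) theta vs =
    select0 (row_mx (new_par theta u) (new_aux theta u)) vs.
  rewrite /reverse_select_prob /select0 row_mxKl weight0_row_mx// addrC.
  rewrite nE.
  by under [in RHS]eq_bigr do rewrite weight0_row_mx//.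
by rewrite /jac0 mem_set.
Qed.

Local Open Scope ereal_scope.

(** Where the trial densities vanish both sides are 0; elsewhere every trial lies in the support,
    where the original functions agree with their extensions by zero. *)
Lemma move_integrandE n m m' (theta : par m) (j : 'I_n.+1) u
    (us : n.-tuple (aux m m')) (B : set (aux m m')) : Theta A m theta ->
  (\prod_(i < n.+1) aux_density A m' theta (tnth (tinsert j u us) i))%:E *
  ((select_prob (m' := m') theta (tinsert j u us) j)%:E *
   (\1_B (tnth (tinsert j u us) j))%:E *
   expect_iid (aux_density A m (new_par theta (tnth (tinsert j u us) j)))
     (fun vs : n.-tuple (aux m' m) =>
       (accept_prob y (k := n.+1) theta (tinsert j u us) j vs)%:E)) =
  (\1_B u)%:E * \int[tuple_measure (lebesgue_rV (adim A m' m)) n]_vs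
    (joint (row_mx theta u) us vs)%:E.
Proof.
move=> Ttheta; rewrite tnth_tinsert.
have -> : (\prod_(i < n.+1) aux_density A m' theta (tnth (tinsert j u us) i))%R =
    (aux0 (row_mx theta u) * trials_lik theta us)%R.
  rewrite (bigD1_ord j)//= tnth_tinsert (aux0_row_mx hS)//; congr (_ * _)%R.
  by apply: eq_bigr => i _; rewrite tnth_tinsert_lift (aux0_row_mx hS).
have aux0_supp p p' (x : pair p p') : aux0 x != 0%R -> supp A p p' x.
  by rewrite /aux0; case: ifPn => [/set_mem//|]; rewrite eqxx.
have lik_supp p p' (eta : par p) (ws : n.-tuple (aux p p')) :
    trials_lik eta ws != 0%R -> forall i, supp A p p' (row_mx eta (tnth ws i)).
  by move=> /prodf_neq0 h i; exact: aux0_supp (h i isT).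
have [T0|] := eqVneq (aux0 (row_mx theta u) * trials_lik theta us)%R 0%R.
  rewrite T0 mul0e integral0_eq ?mule0// => vs _.
  by rewrite /joint row_mxKl T0 !mul0r.
rewrite mulf_eq0 negb_or => /andP[/aux0_supp Su /lik_supp Sus].
have Tnew : Theta A m' (new_par theta u) by exact: (supp_Theta hS (jump_supp hS Su)).
have jE : lsubmx (jump0 (row_mx theta u)) = new_par theta u.
  by rewrite /jump0 mem_set.
have -> : expect_iid (aux_density A m (new_par theta u)) (fun vs =>
      (accept_prob y (k := n.+1) theta (tinsert j u us) j vs)%:E) =
    \int[tuple_measure (lebesgue_rV (adim A m' m)) n]_vs
      (trials_lik (lsubmx (jump0 (row_mx theta u))) vs *
       accept0 (row_mx theta u) us vs)%:E.
  apply: eq_integral => vs _; rewrite jE EFinM.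
  have -> : (\prod_(i < n) aux_density A m (new_par theta u) (tnth vs i))%R =
      trials_lik (new_par theta u) vs.
    by apply: eq_bigr => i _; rewrite (aux0_row_mx hS).
  (* The same dichotomy for the reverse trials, inside the inner integral. *)
  have [->|/lik_supp Svs] := eqVneq (trials_lik (new_par theta u) vs) 0%R.
    by rewrite !mul0e.
  by rewrite accept_probE.
have mF : measurable_fun [set: n.-tuple (aux m' m)] (fun vs =>
    (trials_lik (lsubmx (jump0 (row_mx theta u))) vs *
       accept0 (row_mx theta u) us vs)%R).
  exact: (measurable_reverse (f := cst (row_mx theta u)) (g := cst us)).
have -> : \int[tuple_measure (lebesgue_rV (adim A m' m)) n]_vs
      (joint (row_mx theta u) us vs)%:E =
    (aux0 (row_mx theta u) * trials_lik theta us * select0 (row_mx theta u) us)%:E *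
    \int[tuple_measure (lebesgue_rV (adim A m' m)) n]_vs
      (trials_lik (lsubmx (jump0 (row_mx theta u))) vs *
       accept0 (row_mx theta u) us vs)%:E.
  rewrite -ge0_integralZl_EFin//.
  - by apply: eq_integral => vs _; rewrite /joint row_mxKl EFinM.
  - by move=> vs _; rewrite lee_fin; apply: mulr_ge0;
      [exact: trials_lik_ge0|exact: accept0_ge0].
  - exact/measurable_EFinP.
  - apply: mulr_ge0; last exact: select0_ge0.
    by apply: mulr_ge0; [exact: (aux0_ge0 hS)|exact: trials_lik_ge0].
rewrite select_probE// [in RHS]EFinM.
set a := (_ * trials_lik theta us)%:E; set b := (\1_B u)%:E.
set s := (select0 _ _)%:E; set I := \int[_]_vs _.
by rewrite -!muleA [s * (b * I)]muleCA [LHS]muleCA.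
Qed.

End trial_density.

(** * The transition density *)

Section integral_unique.
Local Open Scope ereal_scope.
Context d (T : measurableType d) (R : realType).
Variable mu : {sigma_finite_measure set T -> \bar R}.

(** Integrability of [f] is not given, but [f] is integrable on each finite-measure piece where it
    is at most [j]. Being real-valued, [f] has countably many such pieces covering the space, and
    uniqueness holds on each. *)
Lemma ge0_integral_ae_eq (f : T -> R) (g : T -> \bar R) :
  measurable_fun setT f -> (forall x, (0 <= f x)%R) -> measurable_fun setT g ->
  (forall B, measurable B -> \int[mu]_(x in B) (f x)%:E = \int[mu]_(x in B) g x) ->
  mu [set x | (f x)%:E != g x] = 0.
Proof.
move=> mf f0 mg fg.
have mEf : measurable_fun setT (EFin \o f) by exact/measurable_EFinP.
have mN : measurable [set x | (f x)%:E != g x].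
  by rewrite -[X in measurable X]setTI; exact: emeasurable_fun_neq.
apply/(negligibleP mu mN).
have [F UF Foo] := sigma_finiteT mu.
have mFr i j : measurable (F i `&` [set x | (f x <= j%:R)%R]).
  apply: measurableI; first by have [] := Foo i.
  by rewrite -[X in measurable X]setTI; exact: measurable_fun_ler.
apply: (@negligibleS _ _ _ _ (\bigcup_i \bigcup_j
    (F i `&` [set x | (f x <= j%:R)%R] `&` [set x | (f x)%:E != g x]))).
  move=> x /= fgx; have : setT x by []; rewrite UF => -[i _ Fx].
  exists i => //; exists (Num.bound (f x)) => //; split => //; split => //=.
  by rewrite ltW// archi_boundP.
apply: negligible_bigcup => i; apply: negligible_bigcup => j.
have [mFi Fi] := Foo i; have mD := mFr i j.
have : ae_eq mu (F i `&` [set x | (f x <= j%:R)%R]) (EFin \o f) g.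
  apply: integral_ae_eq => //; last 2 first.
  - exact: measurable_funTS.
  - by move=> E _ mE; exact: fg.
  apply/integrableP; split; first exact: measurable_funTS.
  apply: (@le_lt_trans _ _ (\int[mu]_(x in F i `&` [set x | (f x <= j%:R)%R]) j%:R%:E)).
    apply: ge0_le_integral => //.
    - by apply: measurableT_comp => //; exact: measurable_funTS.
    - by move=> x [_ /= fj]; rewrite lee_fin ger0_norm.
  rewrite integral_cst// lte_mul_pinfty//.
  apply: le_lt_trans Fi.
  by apply: (le_measure mu (mem_set mD) (mem_set mFi)) => x [].
apply: negligibleS => x [Dx /= fgx] /= /(_ Dx) h.
by move: fgx; rewrite -h eqxx.
Qed.

End integral_unique.

(** * A version of the transition density and its balance equation *)

Section density.
Context (R : realType) (Y : Type) (M : nat) (A : sampler R Y M) (y : Y).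
Hypothesis hS : sampler_spec A y.
Implicit Types (m : 'I_M) (n : nat).

Notation par m := 'rV[R]_(pdim A m).
Notation aux m m' := 'rV[R]_(adim A m m').
Notation pair m m' := 'rV[R]_(pdim A m + adim A m m').

Local Open Scope ereal_scope.

Definition joint_mass n m m' (x : pair m m') : \bar R :=
  \int[tuple_measure (lebesgue_rV (adim A m m')) n]_us
    \int[tuple_measure (lebesgue_rV (adim A m' m)) n]_vs (joint y x us vs)%:E.

(* With n.+1 trials: the n.+1 possible positions of the selected one contribute
   equally. *)
Definition move_density n m m' (x : pair m m') : \bar R :=
  (propose A m m' * n.+1%:R)%:E * joint_mass n x.

Lemma joint_mass_ge0 n m m' (x : pair m m') : 0 <= joint_mass n x.
Proof.
by do 2!apply: integral_ge0 => ? _; rewrite lee_fin; exact: (joint_ge0 hS).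
Qed.

Lemma measurable_joint_inner d (T : measurableType d) n m m'
    (f : T -> pair m m') (g : T -> n.-tuple (aux m m')) :
  measurable_fun setT f -> measurable_fun setT g ->
  measurable_fun setT (fun t =>
    \int[tuple_measure (lebesgue_rV (adim A m' m)) n]_vs
      (joint y (f t) (g t) vs)%:E).
Proof.
move=> mf mg.
pose F (z : T * n.-tuple (aux m' m)) := (joint y (f z.1) (g z.1) z.2)%:E.
apply: (@measurable_ge0_integral_tuple _ _ _
  (lebesgue_rV (adim A m' m)) _ T n F); last first.
  by move=> z; rewrite lee_fin; exact: (joint_ge0 hS).
apply/measurable_EFinP; apply: (measurable_joint hS).
- exact: (measurableT_comp mf measurable_fst).
- exact: (measurableT_comp mg measurable_fst).
- exact: measurable_snd.
Qed.

Lemma measurable_joint_mass n m m' : measurable_fun setT (@joint_mass n m m').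
Proof.
pose F (z : pair m m' * n.-tuple (aux m m')) :=
  \int[tuple_measure (lebesgue_rV (adim A m' m)) n]_vs
      (joint y z.1 z.2 vs)%:E.
apply: (@measurable_ge0_integral_tuple _ _ _
  (lebesgue_rV (adim A m m')) _ (pair m m') n F).
  by apply: measurable_joint_inner; [exact: measurable_fst|exact: measurable_snd].
by move=> z; apply: integral_ge0 => ? _; rewrite lee_fin; exact: (joint_ge0 hS).
Qed.

Lemma measurable_move_density n m m' : measurable_fun setT (@move_density n m m').
Proof. by apply: measurable_funeM; exact: measurable_joint_mass. Qed.

(** For each position [j], integrating the selected trial first gives the same value [I]; the [n.+1]
    positions produce the factor in [move_density]. *)
Lemma move_prob_density n m m' (theta : par m) (B : set (aux m m')) :
  Theta A m theta -> measurable B ->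
  move_prob A y n.+1 m' theta B =
  \int[lebesgue_rV (adim A m m')]_(u in B) move_density n (row_mx theta u).
Proof.
move=> Ttheta mB.
pose G (u : aux m m') (us : n.-tuple (aux m m')) : \bar R := (\1_B u)%:E *
  \int[tuple_measure (lebesgue_rV (adim A m' m)) n]_vs
    (joint y (row_mx theta u) us vs)%:E.
have G0 u us : 0 <= G u us.
  rewrite mule_ge0//; apply: integral_ge0 => vs _; rewrite lee_fin.
  exact: (joint_ge0 hS).
have mrow : measurable_fun setT (fun u : aux m m' => row_mx theta u).
  exact: measurable_row_mx.
have mG d (T : measurableType d) (f : T -> aux m m') (g : T -> n.-tuple (aux m m')) :
    measurable_fun setT f -> measurable_fun setT g ->
    measurable_fun setT (fun t => G (f t) (g t)).
  move=> mf mg; apply: emeasurable_funM.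
    by apply/measurable_EFinP; exact: (measurableT_comp (measurable_indic mB) mf).
  by apply: measurable_joint_inner => //; exact: (measurableT_comp mrow mf).
have mGj (j : 'I_n.+1) : measurable_fun [set: n.+1.-tuple (aux m m')]
    (fun us => G (tnth us j) (tremove j us)).
  by apply: mG; [exact: measurable_tnth|exact: measurable_tremove].
rewrite /move_prob {1}/expect_iid.
under eq_integral => us _.
  rewrite (_ : _ * _ = \sum_(j < n.+1) G (tnth us j) (tremove j us)); last first.
    have GE (j : 'I_n.+1) := move_integrandE hS j (tnth us j) (tremove j us) B Ttheta.
    (* Distributing the product over the sum needs nonnegative terms. If the density product is 0
       both sides vanish; otherwise it is positive, and the sign of each term follows from that of
       [G]. *)
    have [P0|P0] := eqVneq (\prod_(i < n.+1) aux_density A m' theta (tnth us i))%R 0%R.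
      rewrite P0 mul0e big1// => j _; rewrite /G -GE tremoveK P0 mul0e//.
    have Pgt0 : 0 < (\prod_(i < n.+1) aux_density A m' theta (tnth us i))%:E.
      rewrite lte_fin lt_def P0; apply: prodr_ge0 => i _; exact: (aux_density_ge0 hS).
    rewrite ge0_sume_distrr; last first.
      move=> j _; rewrite -(pmule_rge0 _ Pgt0).
      by have := GE j; rewrite tremoveK => ->; exact: G0.
    by apply: eq_bigr => j _; have := GE j; rewrite tremoveK.
  over.
rewrite ge0_integral_sum//.
pose I := \int[lebesgue_rV (adim A m m')]_u ((\1_B u)%:E * joint_mass n (row_mx theta u)).
rewrite (eq_bigr (fun=> I)) => [|j _]; last first.
  rewrite (ge0_integral_tuple_tinsert _ j (mGj j))//; apply: eq_integral => u _.
  transitivity (\int[tuple_measure (lebesgue_rV (adim A m m')) n]_us G u us).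
    by apply: eq_integral => us _; rewrite tnth_tinsert tinsertK.
  rewrite ge0_integralZl_EFin; first by [].
  - exact: measurableT.
  - by move=> us _; apply: integral_ge0 => vs _; rewrite lee_fin; exact: (joint_ge0 hS).
  - exact: measurable_joint_inner.
  - by [].
have -> : \sum_(j < n.+1) I = n.+1%:R%:E * I.
  elim: n.+1 => [|p IH]; first by rewrite big_ord0 mul0e.
  rewrite big_ord_recr/= IH -{2}[I]mul1e -ge0_muleDl ?lee_fin//.
  by rewrite -EFinD natr1.
rewrite muleA -EFinM.
rewrite [RHS]integral_mkcond epatch_indic -ge0_integralZl_EFin//.
- by apply: eq_integral => u _; rewrite /move_density -[RHS]muleA [_ * (\1_B u)%:E]muleC.
- by move=> u _; rewrite mule_ge0//; exact: joint_mass_ge0.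
- apply: emeasurable_funM.
    by apply/measurable_EFinP; exact: measurable_indic.
  exact: (measurableT_comp (@measurable_joint_mass n m m') mrow).
- by rewrite mulr_ge0// (propose_ge0 hS).
Qed.

Lemma joint_reverse n m m' (x : pair m m') (us : n.-tuple (aux m m'))
    (vs : n.-tuple (aux m' m)) : supp A m m' x ->
  (target0 y (lsubmx x) * propose A m m' * joint y x us vs =
   target0 y (lsubmx (jump0 x)) * propose A m' m * jac0 x *
     joint y (jump0 x) vs us)%R.
Proof.
move=> Sx; have Sg := jump_supp hS Sx.
have gE : jump0 x = jump A m m' x by rewrite /jump0 mem_set.
have ggE : jump0 (jump0 x) = x by rewrite gE /jump0 mem_set// (jumpK hS).
have JJ : (jac0 x * jac0 (jump0 x) = 1)%R.
  by rewrite gE /jac0 !mem_set// (abs_jacobian_mul1 hS).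
(* Both sides are minima of two flows. Since the two Jacobians are reciprocal, factoring out
   [jac0 x] exchanges the arguments. *)
have key : (flow y x us * accept0 y x us vs =
    jac0 x * (flow y (jump0 x) vs * accept0 y (jump0 x) vs us))%R.
  rewrite !(flow_accept0 hS) ggE minr_pMr ?jac0_ge0// [RHS]minC.
  by congr Num.min; [rewrite mulrCA JJ mulr1|rewrite mulrC].
transitivity (trials_lik (lsubmx x) us * trials_lik (lsubmx (jump0 x)) vs *
  (flow y x us * accept0 y x us vs))%R; first by rewrite /joint /flow; ring.
by rewrite key /joint /flow ggE; ring.
Qed.

(** Moves constants under both integrals so that balance can be checked on the integrands. *)
Lemma joint_massZl n m m' (x : pair m m') (c : R) : (0 <= c)%R ->
  c%:E * joint_mass n x =
  \int[tuple_measure (lebesgue_rV (adim A m m')) n]_us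
    \int[tuple_measure (lebesgue_rV (adim A m' m)) n]_vs
      (c * joint y x us vs)%:E.
Proof.
move=> c0; rewrite /joint_mass -ge0_integralZl_EFin//.
- apply: eq_integral => us _; rewrite -ge0_integralZl_EFin//.
  + by move=> vs _; rewrite lee_fin; exact: (joint_ge0 hS).
  + by apply/measurable_EFinP; apply: (measurable_joint hS).
- by move=> us _; apply: integral_ge0 => vs _; rewrite lee_fin; exact: (joint_ge0 hS).
- exact: measurable_joint_inner.
Qed.

Lemma move_density_balance n m m' (x : pair m m') : supp A m m' x ->
  (target0 y (lsubmx x))%:E * move_density n x =
  (target0 y (lsubmx (jump0 x)))%:E * move_density n (jump0 x) * (jac0 x)%:E.
Proof.
move=> Sx.
rewrite [RHS]muleAC /move_density !muleA -!EFinM !joint_massZl; last 2 first.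
- by rewrite mulr_ge0 ?mulr_ge0 ?(target0_ge0 hS) ?jac0_ge0 ?(propose_ge0 hS).
- by rewrite !mulr_ge0 ?(target0_ge0 hS) ?(propose_ge0 hS).
pose F (z : n.-tuple (aux m m') * n.-tuple (aux m' m)) : \bar R :=
  (target0 y (lsubmx x) * (propose A m m' * n.+1%:R) * joint y x z.1 z.2)%:E.
have F0 z : 0 <= F z.
  rewrite lee_fin; apply: mulr_ge0; last exact: (joint_ge0 hS).
  by rewrite mulr_ge0 ?(target0_ge0 hS)// mulr_ge0// (propose_ge0 hS).
have mF : measurable_fun setT F.
  apply/measurable_EFinP; apply: measurable_funM => //.
  by apply: (measurable_joint hS).
(* The competitors of one direction are the reverse trials of the other, so the two integrals must
   be exchanged before comparison. *)
transitivity (\int[tuple_measure (lebesgue_rV (adim A m' m)) n]_vs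
    \int[tuple_measure (lebesgue_rV (adim A m m')) n]_us F (us, vs)).
  exact: (@fubini_tonelli _ _ _ _ _
    (tuple_measure (lebesgue_rV (adim A m m')) n)
    (tuple_measure (lebesgue_rV (adim A m' m)) n) F mF F0).
apply: eq_integral => vs _; apply: eq_integral => us _; rewrite /F/=; congr (_%:E).
transitivity (n.+1%:R * (target0 y (lsubmx x) * propose A m m' * joint y x us vs))%R.
  by ring.
by rewrite joint_reverse//; ring.
Qed.

(** At fixed [theta] both densities have the same integral over every measurable set, so each
    section of [N] is null; integrating over [theta] makes [N] null. *)
Lemma move_density_version n (P : forall m m', par m -> aux m m' -> R) m m' :
  transition_density A y n.+1 P ->
  let N := [set x : pair m m' | Theta A m (lsubmx x) /\
    (P m m' (lsubmx x) (rsubmx x))%:E != move_density n x] in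
  measurable N /\ lebesgue_rV _ N = 0.
Proof.
move=> hP N; have [mP PE] := hP m m'.
have mTheta : measurable (Theta A m) by exact: (Theta_measurable hS).
have mPx : measurable_fun (lsubmx @^-1` Theta A m)
    (fun x : pair m m' => P m m' (lsubmx x) (rsubmx x)).
  apply: (measurable_comp (F := Theta A m `*` setT)
    (f := fun z : par m * aux m m' => P m m' z.1 z.2)
    (g := fun x : pair m m' => (lsubmx x, rsubmx x))) => //.
  - exact: measurableX.
  - by move=> _ [x Tx <-].
  - apply: measurable_funTS; apply: measurable_fun_pair.
      exact: measurable_lsubmx.
    exact: measurable_rsubmx.
have mN : measurable N.
  apply: emeasurable_fun_neq.
  - by rewrite -[X in measurable X]setTI; exact: measurable_lsubmx.
  - exact/measurable_EFinP.
  - by apply: measurable_funTS; exact: measurable_move_density.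
split=> //; rewrite -(setIT N) -integral_indic//.
rewrite ge0_integral_lebesgue_row_mx; last 2 first.
- by apply/measurable_EFinP; exact: measurable_indic.
- by move=> x; rewrite lee_fin.
apply: integral0_eq => theta _.
have [Ttheta|nTheta] := pselect (Theta A m theta); last first.
  apply: integral0_eq => u _; rewrite indicE memNset// => -[].
  by rewrite row_mxKl.
have mrow : measurable_fun setT (fun u : aux m m' => row_mx theta u).
  exact: measurable_row_mx.
have [P0 PB] := PE theta Ttheta.
have <- : lebesgue_rV (adim A m m')
    [set u | (P m m' theta u)%:E != move_density n (row_mx theta u)] = 0.
  apply: ge0_integral_ae_eq => //.
  - apply: (measurable_comp (F := Theta A m `*` setT)
      (f := fun z : par m * aux m m' => P m m' z.1 z.2)
      (g := fun u : aux m m' => (theta, u))) => //.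
    + exact: measurableX.
    + by move=> _ [u _ <-].
    + exact: measurable_fun_pair.
  - exact: (measurableT_comp (@measurable_move_density n m m') mrow).
  - by move=> B mB; rewrite PB// move_prob_density.
have -> : [set u | (P m m' theta u)%:E != move_density n (row_mx theta u)] =
    (fun u : aux m m' => row_mx theta u) @^-1` N.
  by apply/seteqP; split=> u; rewrite /N/= row_mxKl row_mxKr => // -[].
have mrN : measurable ((fun u : aux m m' => row_mx theta u) @^-1` N).
  by rewrite -[X in measurable X]setTI; exact: mrow.
by rewrite -[X in _ = _ X]setIT -integral_indic//; apply: eq_integral.
Qed.

End density.

(** * Detailed balance outside a null set *)

Theorem theorem1 (R : realType) (Y : Type) (M : nat) (A : sampler R Y M)
    (y : Y) (k : nat) (hk : (1 <= k)%N) (hS : sampler_spec A y)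
    (P : forall m m' : 'I_M, 'rV[R]_(pdim A m) -> 'rV[R]_(adim A m m') -> R)
    (hP : transition_density A y k P) (m m' : 'I_M) :
  {ae lebesgue_rV (pdim A m + adim A m m'), forall x, supp A m m' x ->
    let theta := lsubmx x in
    let u := rsubmx x in
    let theta' := lsubmx (jump A m m' x) in
    let u' := rsubmx (jump A m m' x) in
    existT (fun i => 'rV[R]_(pdim A i)) m theta <>
      existT (fun i => 'rV[R]_(pdim A i)) m' theta' ->
    target A y theta * P m m' theta u =
      target A y theta' * P m' m theta' u' * abs_jacobian A x}.
Proof.
(* Writing the number of trials as [n.+1] makes [k.-1] compute to [n]. *)
case: k hk hP => [//|n] _ hP.
have [mN N0] := move_density_version hS m m' hP.
have [mN' N'0] := move_density_version hS m' m hP.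
set N := (X in measurable X) in mN N0; set N' := (X in measurable X) in mN' N'0.
have mS : measurable (supp A m' m) by exact: (supp_measurable hS).
(* The exceptional set of the reverse density is cut down to the support, where the reverse jump is
   differentiable. *)
have NS0 : lebesgue_rV _ (N' `&` supp A m' m) = 0%E.
  apply/eqP; rewrite eq_le measure_ge0 andbT -[leRHS]N'0.
  by apply: le_measure; rewrite ?inE//; exact: measurableI.
have imN : (lebesgue_rV (pdim A m + adim A m m')).-negligible
    (jump A m' m @` (N' `&` supp A m' m)).
  apply: null_image_differentiable NS0 _.
  - exact: (dim_matching A m' m).
  - exact: measurableI.
  - by move=> x [_ Sx]; exact: (differentiable_jump hS).
have nN : (lebesgue_rV (pdim A m + adim A m m')).-negligible N.
  exact/negligibleP.
apply: negligibleS (negligibleU nN imN) => x /= bad.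
apply: contrapT => /not_orP[Nx N'x]; apply: bad => Sx _.
have Sg := jump_supp hS Sx.
have Tx := supp_Theta hS Sx; have Tg := supp_Theta hS Sg.
have gE : jump0 x = jump A m m' x by rewrite /jump0 mem_set.
have Px : (P m m' (lsubmx x) (rsubmx x))%:E = move_density y n x.
  by apply/eqP/negPn/negP => neq; apply: Nx.
have Pg : (P m' m (lsubmx (jump A m m' x)) (rsubmx (jump A m m' x)))%:E =
    move_density y n (jump A m m' x).
  (* A failure at [jump A m m' x] would put [x] in the excluded image, since the reverse jump sends
     that point back to [x]. *)
  apply/eqP/negPn/negP => neq; apply: N'x; exists (jump A m m' x) => //.
  exact: (jumpK hS).
have := move_density_balance hS n Sx.
rewrite gE -Px -Pg /target0 /jac0 !mem_set// -!EFinM => -[].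
exact.
Qed.
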